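(* Let $D$ be a two-dimensional regular local ring with fixed regular system of parameters $x,y$, let $0<a<b$ be real numbers, and let $I=[a,b]$. Then the interval ring $T_I$ is not Noetherian and not completely integrally closed.
   Context: $D$ is a two-dimensional regular local ring with maximal ideal $\mathfrak m=(x,y)$ and quotient field $K$. Every nonzero element of $D$ can be written as $u_1\tau_1+\cdots+u_n\tau_n$ with $u_i$ units of $D$ and $\tau_i$ distinct monomials $x^py^q$ ($p,q\ge 0$ integers), none of which divides another in $D$; the set of monomials $\tau_i$ is uniquely determined by the element (and $x,y$). For real $r>0$, the monomial valuation $v_r$ on $K$ is defined by $v_r(0)=\infty$, $v_r(x^py^q)=p+qr$, $v_r(u_1\tau_1+\cdots+u_n\tau_n)=\min_i v_r(\tau_i)$ for such a representation, and $v_r(f/g)=v_r(f)-v_r(g)$ for $f,g\in D$, $g\neq 0$. Its valuation ring is $V_r=\{f\in K: v_r(f)\ge 0\}$. For $I=[a,b]$ the interval ring $T_I$ is the intersection of all valuation rings $V$ such that $D\subseteq V\subseteq V_r$ for some $r\in I$. An element $z\in K$ is almost integral over $T_I$ if there is a nonzero $c\in T_I$ with $cz^n\in T_I$ for all $n\ge 1$; $T_I$ is completely integrally closed if every element of $K$ almost integral over $T_I$ lies in $T_I$. *)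

(* Defs.v *)
From mathcomp Require Import all_boot all_order all_algebra.
From mathcomp Require Import ring_quotient fraction.
From mathcomp Require Import boolp classical_sets reals constructive_ereal.

Set Implicit Arguments.
Unset Strict Implicit.
Unset Printing Implicit Defensive.

Import Order.TTheory GRing.Theory Num.Theory.

Local Open Scope classical_set_scope.
Local Open Scope ring_scope.

(* Rings that live inside an ambient ring [S] are given as sets [A : set S];
   ideals and the Noetherian property are relative to [A], so that the same
   notion applies to [D] itself ([A := setT]) and to subrings of Frac(D). *)
Definition ideal_in (S : comNzRingType) (A J : set S) : Prop :=
  [/\ J `<=` A, J 0,
      forall u v, J u -> J v -> J (u + v)
    & forall a u, A a -> J u -> J (a * u)].

Definition span_in (S : comNzRingType) (A : set S) (n : nat)
    (g : 'I_n -> S) : set S :=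
  [set z | exists2 c : 'I_n -> S,
             forall i, A (c i) & z = \sum_(i < n) c i * g i].

Definition noetherian (S : comNzRingType) (A : set S) : Prop :=
  forall J, ideal_in A J ->
  exists n (g : 'I_n -> S), (forall i, A (g i)) /\ J = span_in A g.

(* [idealr_closed] already demands that the ideal be proper. *)
Definition prime_ideal (S : comNzRingType) (P : set S) : Prop :=
  idealr_closed (mem P) /\ prime_idealr_closed (mem P).

Definition maximal_ideal (S : comNzRingType) (M : set S) : Prop :=
  idealr_closed (mem M) /\
  forall J : set S, idealr_closed (mem J) -> M `<=` J -> J = M.

Definition local_ring_at (S : comNzRingType) (M : set S) : Prop :=
  maximal_ideal M /\ forall N, maximal_ideal N -> N = M.

Definition prime_chain (S : comNzRingType) (n : nat) : Prop :=
  exists P : nat -> set S,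
    (forall i, (i <= n)%N -> prime_ideal (P i)) /\
    (forall i, (i < n)%N -> P i `<` P i.+1).

Definition krull_dim (S : comNzRingType) (n : nat) : Prop :=
  prime_chain S n /\ forall m, prime_chain S m -> (m <= n)%N.

(* [D] is a two-dimensional regular local ring with regular system of
   parameters [x], [y].  The number of generators is minimal automatically,
   the dimension being 2. *)
Definition regular_local2 (D : idomainType) (x y : D) : Prop :=
  [/\ noetherian [set: D],
      local_ring_at [set z | exists u v, z = u * x + v * y]
    & krull_dim D 2].

Definition monomial (D : idomainType) (x y : D) (e : nat * nat) : D :=
  x ^+ e.1 * y ^+ e.2.

Definition divides (D : idomainType) (s t : D) : Prop := exists d, t = d * s.

(* Divisibility being reflexive, the second clause also makes the monomials
   pairwise distinct. *)
Definition monomial_rep (D : idomainType) (x y f : D) (n : nat)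
    (u : 'I_n -> D) (e : 'I_n -> nat * nat) : Prop :=
  [/\ forall i, u i \is a GRing.unit,
      forall i j, i != j -> ~ divides (monomial x y (e i)) (monomial x y (e j))
    & f = \sum_(i < n) u i * monomial x y (e i)].

(* The value does not depend on the representation picked by [xget], and
   a representation of [f != 0] has [n > 0], so the default values [+oo] only
   serve to make the definition total. *)
Definition monomial_val (R : realType) (D : idomainType) (x y : D) (r : R)
    (f : D) : \bar R :=
  if f == 0 then +oo%E else
  xget +oo%E [set t | exists n (u : 'I_n -> D) (e : 'I_n -> nat * nat),
    monomial_rep x y f u e /\
    t = \big[Order.min/+oo%E]_(i < n) ((e i).1%:R + (e i).2%:R * r)%:E].

(* The extension to the quotient field: v(f/g) = v(f) - v(g), which does not
   depend on the fraction chosen; v(0) = +oo. *)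
Definition monomial_valK (R : realType) (D : idomainType) (x y : D) (r : R)
    (z : {fraction D}) : \bar R :=
  xget +oo%E [set t | exists f g : D,
    [/\ g != 0, z = tofrac f / tofrac g
      & t = (monomial_val x y r f - monomial_val x y r g)%E]].

Definition monomial_val_ring (R : realType) (D : idomainType) (x y : D)
    (r : R) : set {fraction D} :=
  [set z | (0 <= monomial_valK x y r z)%E].

Definition valuation_ring (K : fieldType) (V : set K) : Prop :=
  subring_closed (mem V) /\ forall z, z != 0 -> V z \/ V z^-1.

Definition interval_ring (R : realType) (D : idomainType) (x y : D)
    (a b : R) : set {fraction D} :=
  \bigcap_(V in [set V | [/\ valuation_ring V, range (@tofrac D) `<=` V
                & exists2 r : R, a <= r <= b &
                    V `<=` monomial_val_ring x y r]]) V.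

Definition almost_integral (K : fieldType) (T : set K) (z : K) : Prop :=
  exists c, [/\ c != 0, T c & forall n : nat, (1 <= n)%N -> T (c * z ^+ n)].

(* Meant for subrings [T] whose field of fractions is [K]. *)
Definition completely_integrally_closed (K : fieldType) (T : set K) : Prop :=
  forall z, almost_integral T z -> T z.

(* Main.v *)
Require Import Defs.
From mathcomp Require Import all_boot all_order all_algebra.
From mathcomp Require Import ring_quotient fraction ring.
From mathcomp Require Import boolp classical_sets reals constructive_ereal.

Set Implicit Arguments.
Unset Strict Implicit.
Unset Printing Implicit Defensive.

Import Order.TTheory GRing.Theory Num.Theory.

Local Open Scope classical_set_scope.
Local Open Scope ring_scope.

(** Two facts about [T], the interval ring of [a, b], are played against each
    other. An element of [K] whose value at [v_r] is positive for all [r] between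
    [a] and [b] lies in [T], because it lies in the maximal ideal of each [V_r] and
    hence in every valuation ring inside [V_r]. On the other hand, at a rational
    [r0 = p / q] of the open interval, the residue field of [V_r0] contains a
    transcendental element over the residue field of [D], the residue of
    [s = x^p / y^q], so that there are valuation rings [D <= V < V_r0] which
    impose conditions on residues. For [w = 1 + s = (x^p + y^q) / y^q] one has
    [v_r w <= 0] for all [r > 0]; hence [x * w^-n] has positive values and lies
    in [T] for all [n], that is, [w^-1] is almost integral over [T]. But [w^-1]
    is not in [T]: since [s] has a transcendental residue, some [V] inside
    [V_r0] has [w] in its maximal ideal ([rational_avoiding_valuation_ring]).
    So [T] is not completely integrally closed. Were [T] Noetherian, [w^-1]
    would be integral over [T] and would lie in [V]
    ([noetherian_almost_integral]).

    The valuation ring [V] comes from Zorn's lemma: a subring of a field that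
    is maximal among those avoiding the inverse of one of its elements is a
    valuation ring ([maximal_avoiding_valuation_ring]). It lies inside [V_r0]
    as soon as it contains the maximal ideal of [V_r0], since [v_r0] has real
    values ([valuation_ring_inside]).

    All this requires that [v_r] be a valuation which does not depend on
    choices. Order the exponents by their weight [p + q r], then by the
    exponent of [x], and call [e] the leading exponent of [f] ([lead]) if [f]
    is a unit times the monomial of [e] plus an element of the ideal generated
    by later monomials. Leading exponents are unique because [x^i y^j] is not
    in [(x^(i+1), y^(j+1))] ([monomial_notin_corner]), and they add up in
    products; the first monomial of any monomial representation is leading
    ([monomial_rep_lead]).

    The non-membership just quoted, and the existence of representations
    ([staircase_exists]), rest on [x, y] being a regular sequence
    ([param_regular]). From the dimension one only has to extract that no power
    of [y] lies in [xD]; otherwise the maximal ideal would be minimal over [xD],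
    contradicting Krull's principal ideal theorem
    ([principal_ideal_theorem]). *)

(** * Zorn's lemma, ideals, and Noetherian local domains *)

(** Zorn's lemma applied to the sets [A] such that [P] holds of the union of
    [A0] and [A]; for the empty chain this union is [A0]. *)
Lemma zorn_above (T : Type) (P : set (set T)) (A0 : set T) : P A0 ->
  (forall F, F !=set0 -> total_on F subset ->
     (forall A, F A -> A0 `<=` A /\ P A) -> P (\bigcup_(A in F) A)) ->
  exists A, [/\ P A, A0 `<=` A & forall B, A `<=` B -> P B -> B = A].
Proof.
move=> PA0 chainP.
have [|A [PA maxA]] := @Zorn_bigcup T [set A | P (A0 `|` A)].
  move=> F FP Ftot /=; have [F0|/nonemptyPn F0] := pselect (F !=set0); last first.
    by rewrite F0 bigcup_set0 setU0.
  have -> : A0 `|` \bigcup_(X in F) X =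
      \bigcup_(X in [set A0 `|` A | A in F]) X.
    apply/seteqP; split=> t.
      case=> [A0t|[A FA At]].
        by have [A FA] := F0; exists (A0 `|` A); [exists A|left].
      by exists (A0 `|` A); [exists A|right].
    by case=> _ [A FA <-] [A0t|At]; [left|right; exists A].
  apply: chainP.
  - by have [A FA] := F0; exists (A0 `|` A), A.
  - move=> _ _ [A FA <-] [B FB <-].
    by have [AB|BA] := Ftot _ _ FA FB; [left|right]; apply: setUS.
  - by move=> _ [A FA <-]; split; [left|exact: FP].
exists (A0 `|` A); split=> // B AB PB.
apply: contrapT => neqB; apply: (maxA B).
  split; first by move=> t At; apply: AB; right.
  move=> BA; apply: neqB; apply/seteqP; split=> // t Bt.
  by right; apply: BA.
by rewrite /= setUidr // => t A0t; apply: AB; left.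
Qed.

Lemma idealr_closedP (S : comNzRingType) (J : set S) :
  idealr_closed (mem J) <-> ideal_in [set: S] J /\ ~ J 1.
Proof.
split.
  case; rewrite !inE => J0 /negP nJ1 JD.
  have {}JD a u v : J u -> J v -> J (a * u + v).
    by move=> Ju Jv; have := JD a u v; rewrite !inE; apply.
  split; last by move=> J1; apply: nJ1; rewrite inE.
  split=> // [u v Ju Jv|a u _ Ju]; first by rewrite -[u]mul1r; apply: JD.
  by rewrite -[a * u]addr0; apply: JD.
case=> -[_ J0 JD JM] nJ1; split=> [||a u v]; rewrite ?inE //.
  by apply/negP; rewrite inE.
by move=> Ju Jv; apply: JD => //; apply: JM.
Qed.

Lemma ideal_in_opp (S : comNzRingType) (J : set S) u :
  ideal_in [set: S] J -> J u -> J (- u).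
Proof. by case=> _ _ _ JM Ju; rewrite -mulN1r; apply: JM. Qed.

Lemma ideal_in_sub (S : comNzRingType) (J : set S) u v :
  ideal_in [set: S] J -> J u -> J v -> J (u - v).
Proof. by move=> Jid Ju Jv; case: (Jid) => _ _ JD _; apply: JD => //; apply: ideal_in_opp. Qed.

Lemma ideal_in_sum (S : comNzRingType) (J : set S) (I : Type) (r : seq I)
    (P : pred I) (F : I -> S) :
  ideal_in [set: S] J -> (forall i, P i -> J (F i)) ->
  J (\sum_(i <- r | P i) F i).
Proof. by case=> _ J0 JD _ JF; elim/big_rec: _ => // i z /JF; apply: JD. Qed.

Lemma ideal_divides (D : idomainType) (s : D) :
  ideal_in [set: D] (divides s).
Proof.
split=> //; first by exists 0; rewrite mul0r.
  by move=> _ _ [d ->] [e ->]; exists (d + e); rewrite mulrDl.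
by move=> a _ _ [d ->]; exists (a * d); rewrite mulrA.
Qed.

Lemma dividesMl (D : idomainType) (s f : D) : divides s (f * s).
Proof. by exists f. Qed.

Lemma ideal_unit (D : idomainType) (N : set D) (u f : D) :
  ideal_in [set: D] N -> u \is a GRing.unit -> N (u * f) -> N f.
Proof. by case=> _ _ _ NM uu Nuf; rewrite -(mulKr uu f); apply: NM. Qed.

Lemma nonunit_in_maximal (D : idomainType) (f : D) :
  f \isn't a GRing.unit -> exists2 M : set D, maximal_ideal M & M f.
Proof.
move=> nuf.
have [||M [idM fM maxM]] := @zorn_above D
    [set J : set D | idealr_closed (mem J)] (divides f).
- apply/idealr_closedP; split; first exact: ideal_divides.
  by case=> d d1; move/negP: nuf; apply; apply/unitrPr; exists d; rewrite mulrC.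
- move=> F F0 Ftot Fid.
  have {}Fid A : F A -> ideal_in [set: D] A /\ ~ A 1.
    by move=> /Fid[_ /idealr_closedP].
  apply/idealr_closedP; split; last by case=> A /Fid[_ A1] /A1.
  split=> //.
  + by have [A FA] := F0; exists A => //; have [[]] := Fid A FA.
  + move=> u v [A FA Au] [B FB Bv].
    have [AB|BA] := Ftot _ _ FA FB.
      by exists B => //; have [[_ _ BD _] _] := Fid B FB; apply: BD => //; apply: AB.
    by exists A => //; have [[_ _ AD _] _] := Fid A FA; apply: AD => //; apply: BA.
  + move=> a u _ [A FA Au]; exists A => //.
    by have [[_ _ _ AM] _] := Fid A FA; apply: AM.
exists M; last by apply: fM; exists 1; rewrite mul1r.
by split=> // J idJ MJ; apply: maxM.
Qed.

(** Nakayama's lemma, by eliminating the generators of [J] one at a time: the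
    coefficient [1 - c * t] of the last one is a unit. *)
Lemma nakayama (D : idomainType) (t : D) (N J : set D) :
  noetherian [set: D] -> (forall b, 1 - b * t \is a GRing.unit) ->
  ideal_in [set: D] N -> ideal_in [set: D] J ->
  (forall f, J f -> exists2 h, J h & N (f - t * h)) -> J `<=` N.
Proof.
move=> noethD unitt idN idJ JtJ.
case: (idN) => _ N0 ND NM; case: (idJ) => _ J0 JD JM.
have [n [g [_ Jg]]] := noethD J idJ.
have gJ i : J (g i).
  rewrite Jg; exists (fun j => (j == i)%:R) => //.
  rewrite (bigD1 i) //= eqxx mul1r big1 ?addr0 // => j /negbTE ->.
  by rewrite mul0r.
have : forall f, J f -> exists c, N (f - \sum_(i < n) c i * g i).
  by move=> f; rewrite Jg => -[c _ ->]; exists c; rewrite subrr.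
clear Jg; elim: n g gJ => [|n IHn] g gJ genJ.
  by move=> f /genJ[c]; rewrite big_ord0 subr0.
pose w i := widen_ord (leqnSn n) i.
apply: (IHn (g \o w)) => [i|f Jf]; first exact: gJ.
have [h Jh Nh] := JtJ _ (gJ ord_max).
have [c] := genJ h Jh; rewrite big_ord_recr /= => Nc.
have [c'] := genJ f Jf; rewrite big_ord_recr /= => Nc'.
set s := \sum_i _ in Nc; set s' := \sum_i _ in Nc'.
have uc := unitt (c ord_max); pose v := (1 - c ord_max * t)^-1 * t.
have Ng : N (g ord_max - v * s).
  apply: (ideal_unit idN uc).
  rewrite mulrBr /v !mulrA mulrV // mul1r.
  have -> : (1 - c ord_max * t) * g ord_max - t * s =
     (g ord_max - t * h) + t * (h - (s + c ord_max * g ord_max)) by ring.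
  by apply: ND => //; apply: NM.
exists (fun i => c' (w i) + c' ord_max * v * c (w i)).
under eq_bigr do rewrite mulrDl -mulrA.
rewrite big_split /= -mulr_sumr -/s -/s'.
have -> : f - (s' + c' ord_max * v * s) =
  (f - (s' + c' ord_max * g ord_max)) + c' ord_max * (g ord_max - v * s) by ring.
by apply: ND => //; apply: NM.
Qed.

(** Krull's intersection theorem along an element [t] of the maximal ideal that
    is regular modulo [N]: the intersection [J] of the [N + t^n D] satisfies
    [J = N + t J]. *)
Lemma krull_intersection (D : idomainType) (t f : D) (N : set D) :
  noetherian [set: D] -> (forall b, 1 - b * t \is a GRing.unit) ->
  ideal_in [set: D] N -> (forall g, N (t * g) -> N g) ->
  (forall n, exists d, N (f - t ^+ n * d)) -> N f.
Proof.
move=> noethD unitt idN regt; case: (idN) => _ N0 ND NM.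
have regtn n g : N (t ^+ n * g) -> N g.
  by elim: n => [|n IHn]; rewrite ?expr0 ?mul1r // exprS -mulrA => /regt.
apply: (@nakayama D t N [set f | forall n, exists d, N (f - t ^+ n * d)]) => //.
  split=> // [n|g h Jg Jh n|a g _ Jg n].
  - by exists 0; rewrite mulr0 subr0.
  - have [d Nd] := Jg n; have [e Ne] := Jh n; exists (d + e).
    by rewrite mulrDr opprD addrACA; apply: ND.
  - have [d Nd] := Jg n; exists (a * d).
    by rewrite mulrCA -mulrBr; apply: NM.
move=> g Jg; have [d Nd] := Jg 1%N; rewrite expr1 in Nd; exists d => // n.
have [e Ne] := Jg n.+1; exists e; apply: regt.
have -> : t * (d - t ^+ n * e) = (g - t ^+ n.+1 * e) - (g - t * d).
  by rewrite exprS; ring.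
exact: ideal_in_sub.
Qed.

(** * Systems of parameters are regular sequences *)

(** What the dimension hypothesis is used for: modulo either parameter, no
    power of the other one vanishes. *)
Record parameters (D : idomainType) (x y : D) : Prop := MkParameters {
  param_noetherian : noetherian [set: D];
  param_nonunit : forall u v, u * x + v * y \isn't a GRing.unit;
  param_maximal : forall f, f \isn't a GRing.unit ->
    exists u v, f = u * x + v * y;
  param_pow : forall n, ~ divides x (y ^+ n);
  param_pow' : forall n, ~ divides y (x ^+ n) }.

Lemma parameters_sym (D : idomainType) (x y : D) :
  parameters x y -> parameters y x.
Proof.
case=> noethD nuxy maxxy powx powy; split=> // [u v|f /maxxy[u [v ->]]].
  by rewrite addrC.
by exists v, u; rewrite addrC.
Qed.

(** Take out of [f] as many factors [y] modulo [x] as possible: what remains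
    lies outside [(x, y)]. *)
Lemma adic_unit_part (D : idomainType) (x y f : D) m :
  (forall g, g \isn't a GRing.unit -> exists u v, g = u * x + v * y) ->
  ~ (exists d, divides x (f - y ^+ m * d)) ->
  exists j u d, u \is a GRing.unit /\ f = y ^+ j * u + d * x.
Proof.
move=> maxxy; elim: m => [|m IHm] nf.
  by case: nf; exists f; rewrite expr0 mul1r subrr; exists 0; rewrite mul0r.
have [[d [e fE]]|] := pselect (exists d, divides x (f - y ^+ m * d)); last first.
  exact: IHm.
exists m, d, e; split; last by rewrite -fE addrC subrK.
apply: contrapT => /negP/maxxy[u [v dE]]; apply: nf.
exists v; exists (e + y ^+ m * u); move/eqP: fE; rewrite subr_eq => /eqP ->.
by rewrite dE exprSr; ring.
Qed.

(** Krull's principal ideal theorem in the form needed here: if the maximal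
    ideal [(x, y)] is minimal over [xD], then it is the only nonzero prime.
    For a prime [Q] and [0 != q] in [Q], the sets [J k], the contractions of
    the ideals [q^k] of the localization at [Q], decrease; modulo [x] they are
    generated by powers of [y] with bounded exponent, hence two consecutive
    ones agree modulo [x], hence by Nakayama they agree, which makes [q] a unit
    at [Q]. *)
Lemma principal_ideal_theorem (D : idomainType) (x y : D) (Q : set D) (q : D) n :
  noetherian [set: D] -> (forall u v, u * x + v * y \isn't a GRing.unit) ->
  (forall f, f \isn't a GRing.unit -> exists u v, f = u * x + v * y) ->
  divides x (y ^+ n) -> prime_ideal Q -> ~ (Q x /\ Q y) -> Q q -> q = 0.
Proof.
move=> noethD nuxy maxxy xyn [/idealr_closedP[idQ nQ1] primeQ] nQxy Qq.
case: (idQ) => _ Q0 QD QM.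
have {}primeQ u v : Q (u * v) -> Q u \/ Q v.
  move=> Quv; have /orP[] := primeQ u v (mem_set Quv); rewrite inE; by [left|right].
have nQx : ~ Q x.
  move=> Qx; apply: nQxy; split=> //; have [d ydx] := xyn.
  have: Q (y ^+ n) by rewrite ydx; apply: QM.
  elim: n {xyn ydx} => [|n IHn]; first by rewrite expr0 => /nQ1.
  by rewrite exprS => /primeQ[].
have unitx b : 1 - b * x \is a GRing.unit.
  apply: contrapT => /negP/maxxy[u [v E]].
  have := nuxy (u + b) v; rewrite mulrDl addrAC -E subrK.
  by rewrite unitr1.
apply: contrapT => /eqP q0.
pose J k : set D := [set f | exists2 s, ~ Q s & divides (q ^+ k) (s * f)].
have idJ k : ideal_in [set: D] (J k).
  split=> //.
  - by exists 1 => //; rewrite mulr0; exists 0; rewrite mul0r.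
  - move=> f g [s nQs [d sE]] [t nQt [e tE]]; exists (s * t).
      by move/primeQ=> [].
    by exists (t * d + s * e); rewrite mulrDl -!mulrA -sE -tE; ring.
  - move=> a f _ [s nQs [d sE]]; exists s => //.
    by exists (a * d); rewrite -mulrA -sE mulrCA.
have JS k : J k.+1 `<=` J k.
  by move=> f [s nQs [d sE]]; exists s => //; exists (d * q); rewrite sE exprS mulrA.
pose P k j := exists2 g, J k g & divides x (y ^+ j - g).
have [k stab] : exists k, forall j, P k j -> P k.+1 j.
  apply: contrapT => /forallNP unstab.
  have : forall k j, (j < k)%N -> ~ P k j.
    elim=> // k IHk j; rewrite ltnS => jk [g Jg [d ygE]].
    apply: (unstab k) => i Pki; have ki : (k <= i)%N.
      by rewrite leqNgt; apply/negP => /IHk/(_ Pki).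
    exists (y ^+ (i - j) * g); first by case: (idJ k.+1) => _ _ _; apply.
    exists (y ^+ (i - j) * d); rewrite -mulrA -ygE mulrBr -exprD subnK //.
    exact: leq_trans ki.
  move=> /(_ n.+1 n (ltnSn n)); apply; exists 0; first by case: (idJ n.+1).
  by rewrite subr0.
have stabJ f : J k f -> exists2 g, J k.+1 g & divides x (f - g).
  move=> Jf; have [[d fE]|nxf] := pselect (divides x f).
    by exists 0; [case: (idJ k.+1)|rewrite subr0; exists d].
  have [|j [u [d [uu fE]]]] := @adic_unit_part D x y f n maxxy.
    case=> d xf; apply: nxf; rewrite -(subrK (y ^+ n * d) f).
    case: (ideal_divides x) => _ _ xD xM; apply: xD => //.
    by rewrite mulrC; apply: xM.
  have /stab[g Jg [e gE]] : P k j.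
    exists (u^-1 * f); first by case: (idJ k) => _ _ _; apply.
    exists (- u^-1 * d); rewrite fE mulrDr [_ * u]mulrC mulKr //.
    by rewrite opprD addNKr !mulNr mulrA.
  exists (u * g); first by case: (idJ k.+1) => _ _ _; apply.
  by exists (u * e + d); rewrite mulrDl -mulrA -gE fE; ring.
have JkJ : J k `<=` J k.+1.
  apply: (@nakayama D x _ _ noethD unitx (idJ _) (idJ _)) => f Jf.
  have [g Jg [h fgE]] := stabJ f Jf; exists h; last first.
    by rewrite mulrC -fgE opprB addrC subrK.
  have [s nQs [d sE]] : J k (h * x) by rewrite -fgE; apply: ideal_in_sub => //; apply: JS.
  exists (s * x); first by move=> /primeQ[].
  by exists d; rewrite -sE; ring.
have /JkJ[s nQs [d sE]] : J k (q ^+ k).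
  by exists 1; rewrite ?mul1r //; exists 1; rewrite mul1r.
apply: nQs; have -> : s = d * q; last exact: QM.
by apply: (mulIf (expf_neq0 k q0)); rewrite sE exprS mulrA.
Qed.

(** The middle prime of a chain of length two is the nonzero prime to which the
    principal ideal theorem is applied; it cannot contain both parameters,
    being different from the maximal ideal. *)
Lemma regular_local2_parameters (D : idomainType) (x y : D) :
  regular_local2 x y -> parameters x y.
Proof.
case=> noethD [[/idealr_closedP[idM nM1] maxM] uniqM] [[P [primeP chainP]] _].
set M := [set _ | _] in idM nM1 maxM uniqM.
case: (idM) => _ M0 MD MM.
have nuM f : M f -> f \isn't a GRing.unit.
  move=> Mf; apply/negP => uf; apply: nM1.
  by rewrite -(mulVr uf); apply: MM.
have maxxy f : f \isn't a GRing.unit -> M f.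
  by case/nonunit_in_maximal => N /uniqM ->.
have nuxy u v : u * x + v * y \isn't a GRing.unit by apply: nuM; exists u, v.
have [q P1q q0] : exists2 q, P 1%N q & q != 0.
  have [sP01 nP10] := chainP 0%N isT.
  apply: contrapT => nq; apply: nP10 => q P1q.
  have [->|q0] := eqVneq q 0; last by case: nq; exists q.
  by have [/idealr_closedP[[]]] := primeP 0%N isT.
have nP1 : ~ (P 1%N x /\ P 1%N y).
  move=> [P1x P1y]; have [sP12 nP21] := chainP 1%N isT.
  have [P1id _] := primeP 1%N isT; have [P2id _] := primeP 2%N isT.
  have [[_ _ P1D P1M] _] := (idealr_closedP _).1 P1id.
  have sMP1 : M `<=` P 1%N.
    by move=> _ [u [v ->]]; apply: P1D; apply: P1M.
  have P1E := maxM _ P1id sMP1; apply: nP21.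
  by rewrite P1E -(maxM _ P2id (subset_trans sMP1 sP12)).
split=> // n; [move=> xyn|move=> yxn].
  suff: q = 0 by apply/eqP.
  exact: (principal_ideal_theorem noethD nuxy maxxy xyn (primeP 1%N isT) nP1).
suff: q = 0 by apply/eqP.
apply: (@principal_ideal_theorem D y x (P 1%N) q n) => //.
- by move=> u v; rewrite addrC.
- by move=> f /maxxy[u [v ->]]; exists v, u; rewrite addrC.
- exact: primeP.
- by move=> [? ?]; apply: nP1.
Qed.

Lemma unit_sub_mul (D : idomainType) (x y : D) : parameters x y ->
  forall b, 1 - b * y \is a GRing.unit.
Proof.
move=> xy b; apply: contrapT => /negP/(param_maximal xy)[u [v E]].
have := param_nonunit xy u (v + b); rewrite mulrDl addrA -E subrK.
by rewrite unitr1.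
Qed.

Lemma param_neq0 (D : idomainType) (x y : D) : parameters x y -> x != 0.
Proof.
move=> xy; apply/eqP => x0; apply: (param_pow' xy (n := 1)).
by rewrite x0 expr1; exists 0; rewrite mul0r.
Qed.

(** [x, y] is a regular sequence: the ideal [J] of all [f] killed modulo [x] by
    a power of [y] satisfies [J = xD + y J]. *)
Lemma param_regular (D : idomainType) (x y f : D) : parameters x y ->
  divides x (y * f) -> divides x f.
Proof.
move=> xy xyf; have [_ _ xD xM] := ideal_divides x.
apply: (@nakayama D y (divides x) [set g | exists k, divides x (y ^+ k * g)]).
- exact: param_noetherian xy.
- exact: unit_sub_mul xy.
- exact: ideal_divides.
- split=> //.
  + by exists 0%N; rewrite mulr0; exists 0; rewrite mul0r.
  + move=> g h [k xg] [l xh]; exists (k + l)%N.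
    have -> : y ^+ (k + l) * (g + h) = y ^+ l * (y ^+ k * g) + y ^+ k * (y ^+ l * h).
      by rewrite exprD; ring.
    by apply: xD; apply: xM.
  + by move=> a g _ [k xg]; exists k; rewrite mulrCA; apply: xM.
- move=> g [k xg]; have nug : g \isn't a GRing.unit.
    apply/negP => ug; apply: (param_pow xy (n := k)).
    by rewrite -(mulrK ug (y ^+ k)) mulrC; apply: xM.
  have [u [v gE]] := param_maximal xy nug; exists v; last first.
    by exists u; rewrite gE [y * v]mulrC addrK.
  exists k.+1; have -> : y ^+ k.+1 * v = y ^+ k * g - y ^+ k * u * x.
    by rewrite gE exprS; ring.
  by apply: ideal_in_sub xg _; [exact: ideal_divides|exact: dividesMl].
- by exists 1%N; rewrite expr1.
Qed.

Lemma param_regularX (D : idomainType) (x y f : D) n : parameters x y ->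
  divides x (y ^+ n * f) -> divides x f.
Proof.
move=> xy; elim: n => [|n IHn]; rewrite ?expr0 ?mul1r // exprS -mulrA.
by move/(param_regular xy).
Qed.

(** [D/xD] is a discrete valuation ring with uniformizer [y]. *)
Lemma param_unit_part (D : idomainType) (x y f : D) : parameters x y ->
  ~ divides x f ->
  exists j u d, u \is a GRing.unit /\ f = y ^+ j * u + d * x.
Proof.
move=> xy nxf.
have [m] : exists m, ~ exists d, divides x (f - y ^+ m * d).
  apply: contrapT => /forallNP inf; apply: nxf.
  apply: (@krull_intersection D y f (divides x)).
  - exact: param_noetherian xy.
  - exact: unit_sub_mul xy.
  - exact: ideal_divides.
  - by move=> g; apply: param_regular.
  - by move=> n; apply: contrapT => /(inf n).
exact/adic_unit_part/(param_maximal xy).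
Qed.

(** * Monomial ideals and existence of monomial representations *)

Lemma unit_add_mul (D : idomainType) (x y u c : D) : parameters x y ->
  u \is a GRing.unit -> u + x * c \is a GRing.unit.
Proof.
move=> xy uu; have := unit_sub_mul (parameters_sym xy) (- u^-1 * c).
rewrite -(unitrMr _ uu); congr (_ \is a _).
by rewrite mulrBr mulr1 !mulNr mulrN opprK -mulrA mulVKr // mulrC.
Qed.

Lemma divides_cancel (D : idomainType) (s t g : D) : s != 0 ->
  divides (t * s) (g * s) -> divides t g.
Proof.
by move=> s0 [d E]; exists d; apply: (mulIf s0); rewrite E mulrA.
Qed.

Lemma param_regular_pow (D : idomainType) (x y f : D) i k : parameters x y ->
  divides (x ^+ i) (y ^+ k * f) -> divides (x ^+ i) f.
Proof.
move=> xy; elim: i f => [|i IHi] f; first by exists f; rewrite expr0 mulr1.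
move=> xyf.
have /(param_regularX xy)[g fE] : divides x (y ^+ k * f).
  by have [d ->] := xyf; exists (d * x ^+ i); rewrite exprSr mulrA.
have /IHi[d gE] : divides (x ^+ i) (y ^+ k * g).
  by apply: (divides_cancel (param_neq0 xy)); rewrite -exprSr -mulrA -fE.
by exists d; rewrite fE gE exprSr mulrA.
Qed.

(** The ideal generated by the monomials whose exponent of [x] exceeds [e.1]
    and those whose exponent of [y] exceeds [e.2], that is, by the monomials
    that do not divide the monomial with exponent [e]. *)
Definition corner (D : idomainType) (x y : D) (e : nat * nat) : set D :=
  [set f | exists a b, f = a * x ^+ e.1.+1 + b * y ^+ e.2.+1].

Lemma ideal_corner (D : idomainType) (x y : D) e :
  ideal_in [set: D] (corner x y e).
Proof.
split=> //; first by exists 0, 0; rewrite !mul0r addr0.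
  by move=> _ _ [a [b ->]] [c [d ->]]; exists (a + c), (b + d); ring.
by move=> c _ _ [a [b ->]]; exists (c * a), (c * b); ring.
Qed.

Lemma corner_monomial (D : idomainType) (x y : D) e e' :
  (e.1 < e'.1)%N || (e.2 < e'.2)%N -> corner x y e (monomial x y e').
Proof.
rewrite /monomial; case/orP => lt.
  exists (x ^+ (e'.1 - e.1.+1) * y ^+ e'.2), 0.
  by rewrite mul0r addr0 mulrAC -exprD subnK.
exists 0, (x ^+ e'.1 * y ^+ (e'.2 - e.2.+1)).
by rewrite mul0r add0r -mulrA -exprD subnK.
Qed.

(** The common source of all uniqueness statements about monomials. Regularity
    of [x, y] lets one cancel [x ^+ e.1]; a membership then says that
    [y ^+ e.2] is in [xD], up to the unit [1 - b' * y]. *)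
Lemma monomial_notin_corner (D : idomainType) (x y : D) e : parameters x y ->
  ~ corner x y e (monomial x y e).
Proof.
move=> xy [a [b E]]; have x0 := expf_neq0 e.1 (param_neq0 xy).
have [b' bE] : divides (x ^+ e.1) b.
  apply: (param_regular_pow (k := e.2.+1) xy); exists (y ^+ e.2 - a * x).
  have -> : y ^+ e.2.+1 * b = monomial x y e - a * x ^+ e.1.+1.
    by rewrite E addrC addKr mulrC.
  by rewrite /monomial exprS; ring.
apply: (param_pow xy (n := e.2)).
apply: (ideal_unit (ideal_divides x) (unit_sub_mul xy b')).
exists a; apply: (mulfI x0); move: E; rewrite /monomial bE.
move=> E; rewrite mulrBl mul1r mulrBr E !exprS; ring.
Qed.

Lemma divides_monomial (D : idomainType) (x y : D) e e' : parameters x y ->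
  divides (monomial x y e) (monomial x y e') -> (e.1 <= e'.1)%N && (e.2 <= e'.2)%N.
Proof.
move=> xy [d E]; apply: contrapT => /negP; rewrite negb_and -!ltnNge => lt.
apply: (monomial_notin_corner (e := e') xy); rewrite E.
by case: (ideal_corner x y e') => _ _ _; apply=> //; apply: corner_monomial.
Qed.

(** Sums [\sum t.1 * monomial t.2] over lists of pairs in which the exponents
    of [x] increase and those of [y] decrease; the monomials that occur are
    then pairwise incomparable for divisibility. *)
Definition stair (D : idomainType) : rel (D * (nat * nat)) :=
  fun s t => (s.2.1 < t.2.1)%N && (t.2.2 < s.2.2)%N.

Definition staircase (D : idomainType) (s : seq (D * (nat * nat))) : bool :=
  all (fun t => t.1 \is a GRing.unit) s && pairwise (@stair D) s.

Definition stair_sum (D : idomainType) (x y : D) (s : seq (D * (nat * nat))) : D :=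
  \sum_(t <- s) t.1 * monomial x y t.2.

(** Multiplication by [x ^+ n]. *)
Definition stair_shift (D : idomainType) n (s : seq (D * (nat * nat))) :=
  [seq (t.1, (n + t.2.1, t.2.2)%N) | t <- s].

Lemma stair_sum_shift (D : idomainType) (x y : D) n s :
  stair_sum x y (stair_shift n s) = x ^+ n * stair_sum x y s.
Proof.
rewrite /stair_sum big_map mulr_sumr; apply: eq_bigr => t _.
by rewrite /monomial exprD; ring.
Qed.

Lemma staircase_cons (D : idomainType) (u : D) n p s :
  u \is a GRing.unit -> staircase s -> all (fun t => t.2.2 < p)%N s ->
  staircase ((u, (n, p)) :: stair_shift n.+1 s).
Proof.
move=> uu /andP[us ss] sp; rewrite /staircase /= uu /=.
rewrite !all_map pairwise_map; apply/and3P; split=> //.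
  apply/allP => t ts; rewrite /stair /= addSn ltnS leq_addr /=.
  exact: (allP sp).
by apply: sub_pairwise ss => s1 s2; rewrite /stair /= !addSn ltnS ltn_add2l.
Qed.

(** Splitting off the first step of a staircase. Here [f] lies in
    [x^n D + y^p D], with [n] as large as possible; the cofactor of [x^n] is a
    unit times some [y^j] modulo [x] with [j < p], and the coefficient of [x]
    in it is treated in the same way with [j] in place of [p], what remains
    being absorbed in the unit. *)
Lemma staircase_expansion (D : idomainType) (x y : D) p : parameters x y ->
  forall f, exists c s, [/\ f = c * y ^+ p + stair_sum x y s, staircase s
    & all (fun t => t.2.2 < p)%N s].
Proof.
move=> xy; have yx := parameters_sym xy.
elim/ltn_ind: p => p IHp f.
have [[c fE]|nyf] := pselect (divides (y ^+ p) f).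
  by exists c, [::]; split=> //; rewrite /stair_sum big_nil addr0.
pose P n := exists e, divides (y ^+ p) (f - x ^+ n * e).
have [n [e [c fE]] nPn] : exists2 n, P n & ~ P n.+1.
  apply: contrapT => H; apply: nyf.
  apply: (@krull_intersection D x f (divides (y ^+ p))).
  - exact: param_noetherian xy.
  - exact: unit_sub_mul yx.
  - exact: ideal_divides.
  - by move=> g xg; apply: (param_regular_pow (k := 1) yx); rewrite expr1.
  - elim=> [|n IHn]; last by apply: contrapT => nPn; apply: H; exists n.
    by exists f; rewrite expr0 mul1r subrr; exists 0; rewrite mul0r.
have {}fE : f = c * y ^+ p + x ^+ n * e by rewrite -fE subrK.
have [|j [u [g [uu eE]]]] := @param_unit_part D x y e xy.
  move=> [g eE]; apply: nPn; exists g; exists c.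
  by rewrite fE eE exprS; ring.
have jp : (j < p)%N.
  rewrite ltnNge; apply/negP => pj; apply: nPn.
  exists g; exists (c + x ^+ n * y ^+ (j - p) * u).
  by rewrite fE eE -{1}(subnK pj) exprD exprS; ring.
have [c' [s [gE ss sj]]] := IHp j jp g.
exists c, ((u + x * c', (n, j)) :: stair_shift n.+1 s); split.
- rewrite /stair_sum big_cons -/(stair_sum x y _) stair_sum_shift fE eE gE.
  by rewrite /monomial /= exprS; ring.
- by apply: staircase_cons => //; apply: unit_add_mul xy uu.
- rewrite /= jp all_map; apply/allP => t /(allP sj) /=.
  by move=> tj; apply: ltn_trans jp.
Qed.

Lemma staircase_exists (D : idomainType) (x y f : D) : parameters x y ->
  f != 0 -> exists2 s, staircase s & f = stair_sum x y s.
Proof.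
move=> xy f0; have yx := parameters_sym xy.
pose P n := divides (x ^+ n) f.
have [n [e fE] nPn] : exists2 n, P n & ~ P n.+1.
  apply: contrapT => H; move/eqP: f0; apply.
  apply: (@krull_intersection D x f [set 0]).
  - exact: param_noetherian xy.
  - exact: unit_sub_mul yx.
  - split=> // [_ _ -> ->|a _ _ ->]; first exact: addr0.
    exact: mulr0.
  - move=> g /eqP; rewrite /= mulf_eq0 (negbTE (param_neq0 xy)) /=.
    by move/eqP.
  - move=> n; suff [e fE] : P n by exists e; rewrite fE /= mulrC subrr.
    elim: n => [|n IHn]; first by exists f; rewrite expr0 mulr1.
    by apply: contrapT => nPn; apply: H; exists n.
have [|j [u [g [uu eE]]]] := @param_unit_part D x y e xy.
  by move=> [g eE]; apply: nPn; exists g; rewrite fE eE exprS; ring.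
have [c [s [gE ss sj]]] := staircase_expansion j xy g.
exists ((u + x * c, (n, j)) :: stair_shift n.+1 s).
  by apply: staircase_cons => //; apply: unit_add_mul xy uu.
rewrite /stair_sum big_cons -/(stair_sum x y _) stair_sum_shift fE eE gE.
by rewrite /monomial /= exprS; ring.
Qed.

Lemma monomial_rep_exists (D : idomainType) (x y f : D) : parameters x y ->
  f != 0 -> exists n (u : 'I_n -> D) e, monomial_rep x y f u e.
Proof.
move=> xy /(staircase_exists xy)[s /andP[/allP us /pairwiseP ss] fE].
pose t0 : D * (nat * nat) := (0, (0, 0)%N).
have {}ss := ss t0.
exists (size s), (fun i => (nth t0 s i).1), (fun i => (nth t0 s i).2).
split=> [i|i j neqij|].
- by apply: us; apply: mem_nth.
- move/(divides_monomial xy); apply/negP; rewrite negb_and -!ltnNge.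
  have := neqij; rewrite neq_ltn => /orP[ij|ji].
    by have /andP[_ ->] := ss i j (ltn_ord i) (ltn_ord j) ij; rewrite orbT.
  by have /andP[-> _] := ss j i (ltn_ord j) (ltn_ord i) ji.
- by rewrite fE /stair_sum (big_nth t0) big_mkord.
Qed.

(** * Leading exponents *)

Definition weight (R : realType) (r : R) (e : nat * nat) : R :=
  e.1%:R + e.2%:R * r.

(** Exponents ordered by weight, ties being broken by the exponent of [x].
    For [r > 0] this is a total order compatible with addition in which a
    proper multiple of a monomial comes after it. *)
Definition weight_key (R : realType) (r : R) (e : nat * nat) : (R *l nat)%type :=
  (weight r e, e.1).

Definition before (R : realType) (r : R) (e e' : nat * nat) : bool :=
  (weight_key r e < weight_key r e')%O.

Definition eadd (e e' : nat * nat) : nat * nat := (e.1 + e'.1, e.2 + e'.2)%N.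

Lemma beforeE (R : realType) (r : R) e e' :
  before r e e' = (weight r e <= weight r e') &&
    ((weight r e' <= weight r e) ==> (e.1 < e'.1)%N).
Proof. by rewrite /before ltEprodlexi. Qed.

Lemma before_weight (R : realType) (r : R) e e' :
  before r e e' -> weight r e <= weight r e'.
Proof. by rewrite beforeE => /andP[]. Qed.

Lemma weight_before (R : realType) (r : R) e e' :
  weight r e < weight r e' -> before r e e'.
Proof. by move=> lt; rewrite beforeE (ltW lt) leNgt lt. Qed.

Lemma before_trans (R : realType) (r : R) e1 e2 e3 :
  before r e1 e2 -> before r e2 e3 -> before r e1 e3.
Proof. exact: lt_trans. Qed.

Lemma weight_key_inj (R : realType) (r : R) : 0 < r -> injective (weight_key r).
Proof.
move=> r0 [i j] [i' j'] [/[swap] <-]; rewrite /weight /=.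
by move/addrI/(mulIf (lt0r_neq0 r0))/eqP; rewrite eqr_nat => /eqP ->.
Qed.

Lemma before_total (R : realType) (r : R) e e' : 0 < r ->
  [\/ e = e', before r e e' | before r e' e].
Proof.
move=> r0; rewrite /before; case: (ltgtP (weight_key r e) (weight_key r e')).
- by constructor 2.
- by constructor 3.
- by move/(weight_key_inj r0); constructor 1.
Qed.

Lemma weight_eadd (R : realType) (r : R) e e' :
  weight r (eadd e e') = weight r e + weight r e'.
Proof. by rewrite /weight /= !natrD; ring. Qed.

Lemma before_eadd (R : realType) (r : R) e e1 e2 :
  before r (eadd e e1) (eadd e e2) = before r e1 e2.
Proof. by rewrite !beforeE !weight_eadd !lerD2l /= ltn_add2l. Qed.

Lemma before_exponent (R : realType) (r : R) e e' : 0 < r ->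
  before r e e' -> (e.1 < e'.1)%N || (e.2 < e'.2)%N.
Proof.
move=> r0; apply: contraTT; rewrite negb_or -!leqNgt => /andP[le1 le2].
have le : weight r e' <= weight r e.
  by apply: lerD; rewrite ?ler_nat //; apply: ler_wpM2r (ltW r0) _ _ _; rewrite ler_nat.
by rewrite beforeE le [(e.1 < _)%N]ltnNge le1 andbF.
Qed.

Lemma monomial_eadd (D : idomainType) (x y : D) e e' :
  monomial x y (eadd e e') = monomial x y e * monomial x y e'.
Proof. by rewrite /monomial !exprD; ring. Qed.

(** The ideal generated by the monomials with exponent after [e], as the
    intersection of the ideals that contain them: to include it in an ideal it
    suffices to look at these monomials. *)
Definition beyond (R : realType) (D : idomainType) (x y : D) (r : R)
    (e : nat * nat) : set D :=
  [set f | forall J, ideal_in [set: D] J ->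
    (forall e', before r e e' -> J (monomial x y e')) -> J f].

Lemma ideal_beyond (R : realType) (D : idomainType) (x y : D) (r : R) e :
  ideal_in [set: D] (beyond x y r e).
Proof.
split=> // [J [_ J0 _ _]|f g Lf Lg J idJ mJ|a f _ Lf J idJ mJ] //.
  by case: (idJ) => _ _ JD _; apply: JD; [apply: Lf|apply: Lg].
by case: (idJ) => _ _ _ JM; apply: JM => //; apply: Lf.
Qed.

Lemma beyond_monomial (R : realType) (D : idomainType) (x y : D) (r : R) e e' :
  before r e e' -> beyond x y r e (monomial x y e').
Proof. by move=> lt J _; apply. Qed.

Lemma beyond_sub (R : realType) (D : idomainType) (x y : D) (r : R) e e' :
  before r e e' -> beyond x y r e' `<=` beyond x y r e.
Proof.
move=> lt f Lf; apply: Lf; first exact: ideal_beyond.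
by move=> e'' /(before_trans lt); apply: beyond_monomial.
Qed.

(** A monomial that comes after [e] does not divide the monomial of [e]. *)
Lemma beyond_corner (R : realType) (D : idomainType) (x y : D) (r : R) e :
  0 < r -> beyond x y r e `<=` corner x y e.
Proof.
move=> r0 f Lf; apply: Lf; first exact: ideal_corner.
by move=> e' /(before_exponent r0); apply: corner_monomial.
Qed.

Lemma ideal_colon (D : idomainType) (N : set D) (g : D) :
  ideal_in [set: D] N -> ideal_in [set: D] [set f | N (g * f)].
Proof.
case=> _ N0 ND NM; split=> // [|f h /= Nf Nh|a f _ /= Nf] /=.
- by rewrite mulr0.
- by rewrite mulrDr; apply: ND.
- by rewrite mulrCA; apply: NM.
Qed.

Lemma beyond_mul_monomial (R : realType) (D : idomainType) (x y : D) (r : R) e e' f :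
  beyond x y r e' f -> beyond x y r (eadd e e') (monomial x y e * f).
Proof.
move=> Lf; pose J := [set g | beyond x y r (eadd e e') (monomial x y e * g)].
apply: (Lf J); first exact/ideal_colon/ideal_beyond.
by move=> e'' lt; rewrite /J /= -monomial_eadd; apply: beyond_monomial; rewrite before_eadd.
Qed.

Lemma eaddC e e' : eadd e e' = eadd e' e.
Proof. by rewrite /eadd addnC [(e.2 + _)%N]addnC. Qed.

Lemma beyond_mul (R : realType) (D : idomainType) (x y : D) (r : R) e e' f f' :
  beyond x y r e f -> beyond x y r e' f' -> beyond x y r (eadd e e') (f * f').
Proof.
move=> Lf Lf'; pose J := [set g | beyond x y r (eadd e e') (f * g)].
apply: (Lf' J); first exact/ideal_colon/ideal_beyond.
move=> e'' lt; rewrite /J /= mulrC.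
apply: (@beyond_sub _ _ _ _ _ _ (eadd e'' e)).
  by rewrite (eaddC e'') before_eadd.
exact: beyond_mul_monomial.
Qed.

(** [u] times the monomial of [e] is the leading term of [f], the monomial of
    least exponent coming first. *)
Definition lead (R : realType) (D : idomainType) (x y : D) (r : R) (f : D)
    (e : nat * nat) : Prop :=
  exists u l, [/\ u \is a GRing.unit, beyond x y r e l
    & f = u * monomial x y e + l].

Lemma lead_beyond (R : realType) (D : idomainType) (x y : D) (r : R) f e :
  parameters x y -> 0 < r -> lead x y r f e -> ~ beyond x y r e f.
Proof.
move=> xy r0 [u [l [uu Ll fE]]] Lf; apply: (monomial_notin_corner (e := e) xy).
apply: (ideal_unit (ideal_corner x y e) uu); apply: (beyond_corner r0).
rewrite -(addrK l (u * _)) -fE.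
by apply: ideal_in_sub Lf Ll; apply: ideal_beyond.
Qed.

Lemma before_lead_beyond (R : realType) (D : idomainType) (x y : D) (r : R) f e e' :
  before r e e' -> lead x y r f e' -> beyond x y r e f.
Proof.
move=> lt [u [l [_ Ll ->]]]; case: (ideal_beyond x y r e) => _ _ LD LM.
by apply: LD; [apply: LM => //; apply: beyond_monomial|apply: beyond_sub Ll].
Qed.

Lemma lead_uniq (R : realType) (D : idomainType) (x y : D) (r : R) f e e' :
  parameters x y -> 0 < r -> lead x y r f e -> lead x y r f e' -> e = e'.
Proof.
move=> xy r0 le le'; case: (@before_total R r e e' r0) => // lt.
  by case: (lead_beyond xy r0 le); apply: before_lead_beyond le'.
by case: (lead_beyond xy r0 le'); apply: before_lead_beyond le.
Qed.

Lemma lead_neq0 (R : realType) (D : idomainType) (x y : D) (r : R) f e :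
  parameters x y -> 0 < r -> lead x y r f e -> f != 0.
Proof.
move=> xy r0 le; apply/eqP => f0; apply: (lead_beyond xy r0 le).
by rewrite f0; case: (ideal_beyond x y r e).
Qed.

Lemma lead_monomial (R : realType) (D : idomainType) (x y : D) (r : R) e :
  lead x y r (monomial x y e) e.
Proof.
exists 1, 0; rewrite unitr1 mul1r addr0; split=> //.
by case: (ideal_beyond x y r e).
Qed.

Lemma lead_mul (R : realType) (D : idomainType) (x y : D) (r : R) f f' e e' :
  lead x y r f e -> lead x y r f' e' -> lead x y r (f * f') (eadd e e').
Proof.
move=> [u [l [uu Ll ->]]] [u' [l' [uu' Ll' ->]]].
case: (ideal_beyond x y r (eadd e e')) => _ _ LD LM.
exists (u * u'), (u * (monomial x y e * l') + u' * (monomial x y e' * l) + l * l').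
split; [by rewrite unitrM uu| |by rewrite monomial_eadd; ring].
apply: (LD); last exact: beyond_mul.
apply: LD; apply: LM => //; first exact: beyond_mul_monomial.
by rewrite eaddC; apply: beyond_mul_monomial.
Qed.

(** The first monomial of a representation leads: as the monomials do not divide
    each other, their exponents are distinct and all others come strictly
    later. *)
Lemma monomial_rep_lead (R : realType) (D : idomainType) (x y : D) (r : R) f n
    (u : 'I_n -> D) e : 0 < r -> f != 0 -> monomial_rep x y f u e ->
  exists2 i, lead x y r f (e i) &
    \big[Order.min/+oo%E]_(i < n) ((e i).1%:R + (e i).2%:R * r)%:E =
      (weight r (e i))%:E.
Proof.
move=> r0 f0 [uu ndiv fE].
case: n u e uu ndiv fE => [|n] u e uu ndiv fE.
  by move: f0; rewrite fE big_ord0 eqxx.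
case: (@Order.TotalTheory.arg_minP _ _ _ ord0 predT (weight_key r \o e) isT) => i _ imin.
have {}imin j : j != i -> before r (e i) (e j).
  move=> neqji; rewrite /before lt_neqAle imin // andbT.
  apply: contraNneq neqji => /(weight_key_inj r0) eij.
  apply: contrapT => /negP/ndiv; apply; rewrite eij.
  by exists 1; rewrite mul1r.
exists i.
  exists (u i), (\sum_(j < n.+1 | j != i) u j * monomial x y (e j)).
  split=> //; last by rewrite fE (bigD1 i).
  apply: ideal_in_sum => [|j /imin lt]; first exact: ideal_beyond.
  by case: (ideal_beyond x y r (e i)) => _ _ _; apply=> //; apply: beyond_monomial.
apply: le_anti; rewrite bigmin_le //=; apply: le_bigmin; first exact: leey.
move=> j _; rewrite lee_fin; have [->//|/imin] := eqVneq j i.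
exact: before_weight.
Qed.

Lemma lead_exists (R : realType) (D : idomainType) (x y : D) (r : R) f :
  parameters x y -> 0 < r -> f != 0 -> exists e, lead x y r f e.
Proof.
move=> xy r0 f0; have [n [u [e fE]]] := monomial_rep_exists xy f0.
by have [i le _] := monomial_rep_lead r0 f0 fE; exists (e i).
Qed.

Lemma monomial_val_lead (R : realType) (D : idomainType) (x y : D) (r : R) f e :
  parameters x y -> 0 < r -> lead x y r f e ->
  monomial_val x y r f = (weight r e)%:E.
Proof.
move=> xy r0 le; have f0 := lead_neq0 xy r0 le.
rewrite /monomial_val (negbTE f0); apply: xget_subset1.
  have [n [u [e' fE]]] := monomial_rep_exists xy f0; exists n, u, e'; split=> //.
  by have [i /(lead_uniq xy r0 le) -> ->] := monomial_rep_lead r0 f0 fE.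
move=> _ _ [n [u [e1 [fE ->]]]] [m [w [e2 [fE' ->]]]].
have [i /(lead_uniq xy r0 le) <- ->] := monomial_rep_lead r0 f0 fE.
by have [j /(lead_uniq xy r0 le) <- ->] := monomial_rep_lead r0 f0 fE'.
Qed.

(** * Real valuations on a field *)

Record real_valuation (R : realType) (K : fieldType) (v : K -> R) : Prop :=
  RealValuation {
    real_valuationM : forall w z, w != 0 -> z != 0 -> v (w * z) = v w + v z;
    real_valuationD : forall w z, w != 0 -> z != 0 -> w + z != 0 ->
      Num.min (v w) (v z) <= v (w + z) }.

(** Real valuations take no infinite value here, so the premise [z != 0] is what
    puts [0] into the ring and into its maximal ideal. *)
Definition valuation_ideal (R : realType) (K : fieldType) (v : K -> R) : set K :=
  [set z | z != 0 -> 0 < v z].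

Definition real_valuation_ring (R : realType) (K : fieldType) (v : K -> R) : set K :=
  [set z | z != 0 -> 0 <= v z].

Lemma real_valuation1 (R : realType) (K : fieldType) (v : K -> R) :
  real_valuation v -> v 1 = 0.
Proof.
case=> vM _; have := vM 1 1 (oner_neq0 _) (oner_neq0 _); rewrite mulr1.
by move/eqP; rewrite -subr_eq0 opprD addNKr oppr_eq0 => /eqP.
Qed.

Lemma real_valuationV (R : realType) (K : fieldType) (v : K -> R) z :
  real_valuation v -> z != 0 -> v z^-1 = - v z.
Proof.
move=> vv z0; apply/eqP; rewrite -addr_eq0 -(real_valuationM vv) ?invr_eq0 //.
by rewrite mulVf // real_valuation1.
Qed.

Lemma real_valuationX (R : realType) (K : fieldType) (v : K -> R) z n :
  real_valuation v -> z != 0 -> v (z ^+ n) = v z *+ n.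
Proof.
move=> vv z0; elim: n => [|n IHn]; first by rewrite expr0 real_valuation1.
by rewrite exprS (real_valuationM vv) ?expf_neq0 // IHn mulrS.
Qed.

Lemma real_valuationN (R : realType) (K : fieldType) (v : K -> R) z :
  real_valuation v -> v (- z) = v z.
Proof.
move=> vv; have [->|z0] := eqVneq z 0; first by rewrite oppr0.
have N10 : (-1 : K) != 0 by rewrite oppr_eq0 oner_neq0.
have : v (-1) *+ 2 = 0 by rewrite -real_valuationX // sqrrN expr1n real_valuation1.
move/eqP; rewrite mulrn_eq0 /= => /eqP vN1.
by rewrite -mulN1r (real_valuationM vv) // vN1 add0r.
Qed.

Lemma valuation_ideal_sub (R : realType) (K : fieldType) (v : K -> R) w z :
  real_valuation v -> valuation_ideal v w -> valuation_ideal v z ->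
  valuation_ideal v (w - z).
Proof.
move=> vv mw mz; have [->|z0] := eqVneq z 0; first by rewrite subr0.
have [->|w0] := eqVneq w 0.
  by move=> _; rewrite sub0r real_valuationN //; apply: mz.
move=> wz0; apply: lt_le_trans (real_valuationD vv w0 _ wz0); last by rewrite oppr_eq0.
by rewrite real_valuationN // lt_min (mw w0) (mz z0).
Qed.

Lemma valuation_ideal_mul (R : realType) (K : fieldType) (v : K -> R) w z :
  real_valuation v -> real_valuation_ring v w -> valuation_ideal v z ->
  valuation_ideal v (w * z).
Proof.
move=> vv ow mz; rewrite /valuation_ideal /= mulf_eq0 negb_or => /andP[w0 z0].
by rewrite (real_valuationM vv) //; apply: ltr_wpDl (ow w0) (mz z0).
Qed.

Lemma real_valuation_ring_add (R : realType) (K : fieldType) (v : K -> R) w z :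
  real_valuation v -> real_valuation_ring v w -> real_valuation_ring v z ->
  real_valuation_ring v (w + z).
Proof.
move=> vv ow oz; have [->|z0] := eqVneq z 0; first by rewrite addr0.
have [->|w0] := eqVneq w 0; first by rewrite add0r.
move=> wz0; apply: le_trans (real_valuationD vv w0 z0 wz0).
by rewrite le_min (ow w0) (oz z0).
Qed.

Lemma real_valuation_ring_mul (R : realType) (K : fieldType) (v : K -> R) w z :
  real_valuation v -> real_valuation_ring v w -> real_valuation_ring v z ->
  real_valuation_ring v (w * z).
Proof.
move=> vv ow oz; rewrite /real_valuation_ring /= mulf_eq0 negb_or => /andP[w0 z0].
by rewrite (real_valuationM vv) //; apply: addr_ge0 (ow w0) (oz z0).
Qed.

(** * The monomial valuations of the quotient field *)

Lemma fraction_rep (D : idomainType) (z : {fraction D}) :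
  exists f g : D, g != 0 /\ z = tofrac f / tofrac g.
Proof.
elim/quotW: z => t; exists t.1, t.2; have t0 := denom_ratioP t; split=> //.
apply: (canRL (mulfK _)); first by rewrite tofrac_eq0.
unlock FracField.tofrac; rewrite -[LHS]FracField.pi_mul; apply/eqmodP => /=.
rewrite FracField.equivfE /FracField.mulf /= !numden_Ratio ?mulf_neq0 ?oner_neq0 //.
by rewrite !mulr1 mulrC.
Qed.

(** The monomial valuation with values in [R] instead of the extended reals. *)
Definition frac_val (R : realType) (D : idomainType) (x y : D) (r : R)
    (z : {fraction D}) : R :=
  xget 0 [set t | exists f g e e', [/\ lead x y r f e, lead x y r g e',
    z = tofrac f / tofrac g & t = weight r e - weight r e']].

Lemma frac_valE (R : realType) (D : idomainType) (x y : D) (r : R) f g e e' :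
  parameters x y -> 0 < r -> lead x y r f e -> lead x y r g e' ->
  frac_val x y r (tofrac f / tofrac g) = weight r e - weight r e'.
Proof.
move=> xy r0 le le'.
have val_uniq f1 g1 e1 e1' t : lead x y r f1 e1 -> lead x y r g1 e1' ->
    tofrac f / tofrac g = tofrac f1 / tofrac g1 -> t = weight r e1 - weight r e1' ->
    t = weight r e - weight r e'.
  move=> le1 le1' /eqP; rewrite eqr_div ?tofrac_eq0 ?(lead_neq0 xy r0 le1') //.
    rewrite -!tofracM tofrac_eq => /eqP E ->.
    have := lead_mul le le1'; rewrite E mulrC => /(lead_uniq xy r0 (lead_mul le' le1)).
    move/(congr1 (weight r)); rewrite !weight_eadd => E'.
    by apply/eqP; rewrite subr_eq addrAC eq_sym subr_eq [X in _ == X]addrC E' addrC.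
  exact: lead_neq0 le'.
apply: xget_subset1; first by exists f, g, e, e'.
move=> t1 t2 [f1 [g1 [e1 [e1' [le1 le1' E1 E1']]]]].
move=> [f2 [g2 [e2 [e2' [le2 le2' E2 E2']]]]].
by rewrite (val_uniq _ _ _ _ _ le1 le1' E1 E1') (val_uniq _ _ _ _ _ le2 le2' E2 E2').
Qed.

Lemma fraction_lead (R : realType) (D : idomainType) (x y : D) (r : R) z :
  parameters x y -> 0 < r -> z != 0 -> exists f g e e',
  [/\ lead x y r f e, lead x y r g e' & z = tofrac f / tofrac g].
Proof.
move=> xy r0; have [f [g [g0 ->]]] := fraction_rep z.
rewrite mulf_eq0 negb_or tofrac_eq0 => /andP[f0 _].
have [e le] := lead_exists xy r0 f0; have [e' le'] := lead_exists xy r0 g0.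
by exists f, g, e, e'.
Qed.

(** If the leading exponent [s] of the sum came before those of both summands,
    the sum would be an element of the ideal [beyond s]. *)
Lemma lead_add_weight (R : realType) (D : idomainType) (x y : D) (r : R) f g e e' s :
  parameters x y -> 0 < r -> lead x y r f e -> lead x y r g e' ->
  lead x y r (f + g) s -> Num.min (weight r e) (weight r e') <= weight r s.
Proof.
move=> xy r0 le le' ls; rewrite leNgt lt_min; apply/negP => /andP[lt lt'].
apply: (lead_beyond xy r0 ls); case: (ideal_beyond x y r s) => _ _ LD _.
apply: LD; [apply: before_lead_beyond le|apply: before_lead_beyond le'];
  exact: weight_before.
Qed.

Lemma frac_val_valuation (R : realType) (D : idomainType) (x y : D) (r : R) :
  parameters x y -> 0 < r -> real_valuation (frac_val x y r).
Proof.
move=> xy r0; split=> w z.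
  move=> /(fraction_lead xy r0)[f [g [e [e' [le le' ->]]]]].
  move=> /(fraction_lead xy r0)[f1 [g1 [e1 [e1' [le1 le1' ->]]]]].
  rewrite mulf_div -!tofracM (frac_valE xy r0 (lead_mul le le1) (lead_mul le' le1')).
  rewrite (frac_valE xy r0 le le') (frac_valE xy r0 le1 le1').
  by rewrite !weight_eadd opprD addrACA.
move=> /(fraction_lead xy r0)[f [g [e [e' [le le' ->]]]]].
move=> /(fraction_lead xy r0)[f1 [g1 [e1 [e1' [le1 le1' ->]]]]].
have g0 := lead_neq0 xy r0 le'; have g10 := lead_neq0 xy r0 le1'.
rewrite addf_div ?tofrac_eq0 // -!tofracM -tofracD.
rewrite mulf_eq0 negb_or tofrac_eq0 => /andP[sum0 _].
have [s ls] := lead_exists xy r0 sum0.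
have := lead_add_weight xy r0 (lead_mul le le1') (lead_mul le1 le') ls.
rewrite (frac_valE xy r0 ls (lead_mul le' le1')).
rewrite (frac_valE xy r0 le le') (frac_valE xy r0 le1 le1').
rewrite !weight_eadd !ge_min => /orP[H|H]; apply/orP; [left|right].
  by rewrite lerBrDr addrA subrK.
by rewrite lerBrDr [weight r e' + _]addrC addrA subrK.
Qed.

Lemma frac_val_tofrac (R : realType) (D : idomainType) (x y : D) (r : R) f e :
  parameters x y -> 0 < r -> lead x y r f e ->
  frac_val x y r (tofrac f) = weight r e.
Proof.
move=> xy r0 le; rewrite -[tofrac f]divr1 -(tofrac1 D).
have -> : (1 : D) = monomial x y (0, 0)%N by rewrite /monomial !expr0 mulr1.
rewrite (frac_valE xy r0 le (lead_monomial x y r _)).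
by rewrite {2}/weight mul0r addr0 subr0.
Qed.

Lemma tofrac_ring (R : realType) (D : idomainType) (x y : D) (r : R) f :
  parameters x y -> 0 < r -> real_valuation_ring (frac_val x y r) (tofrac f).
Proof.
move=> xy r0; rewrite /real_valuation_ring /= tofrac_eq0.
move=> /(lead_exists xy r0)[e le]; rewrite (frac_val_tofrac xy r0 le).
by rewrite addr_ge0 ?mulr_ge0 // ltW.
Qed.

Lemma monomial_valK_frac_val (R : realType) (D : idomainType) (x y : D) (r : R) z :
  parameters x y -> 0 < r -> z != 0 ->
  monomial_valK x y r z = (frac_val x y r z)%:E.
Proof.
move=> xy r0 z0; apply: xget_subset1.
  have [f [g [e [e' [le le' zE]]]]] := fraction_lead xy r0 z0.
  exists f, g; split=> //; first exact: lead_neq0 le'.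
  rewrite zE (frac_valE xy r0 le le') (monomial_val_lead xy r0 le).
  by rewrite (monomial_val_lead xy r0 le').
suff valE t f g : g != 0 -> z = tofrac f / tofrac g ->
    t = (monomial_val x y r f - monomial_val x y r g)%E -> t = (frac_val x y r z)%:E.
  by move=> t1 t2 [f [g [g0 /valE E /E ->]]] // [f1 [g1 [g10 /valE E1 /E1 ->]]].
move=> g0 zE ->; have f0 : f != 0.
  by apply: contraNneq z0 => f0; rewrite zE f0 tofrac0 mul0r.
have [e le] := lead_exists xy r0 f0; have [e' le'] := lead_exists xy r0 g0.
rewrite zE (frac_valE xy r0 le le') (monomial_val_lead xy r0 le).
by rewrite (monomial_val_lead xy r0 le').
Qed.

Lemma monomial_val_ringE (R : realType) (D : idomainType) (x y : D) (r : R) :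
  parameters x y -> 0 < r ->
  monomial_val_ring x y r = real_valuation_ring (frac_val x y r).
Proof.
move=> xy r0; apply/seteqP; rewrite /monomial_val_ring /real_valuation_ring.
split=> z /= Hz; last first.
  have [->|z0] := eqVneq z 0; last first.
    by rewrite monomial_valK_frac_val // lee_fin; apply: Hz.
  rewrite (_ : monomial_valK x y r 0 = +oo%E); first exact: leey.
  have val0 f g t : g != 0 -> 0 = tofrac f / tofrac g ->
      t = (monomial_val x y r f - monomial_val x y r g)%E -> t = +oo%E.
    move=> g0 /esym/eqP; rewrite mulf_eq0 invr_eq0 !tofrac_eq0 (negbTE g0) orbF.
    move=> f0 ->; rewrite /monomial_val f0 -/(monomial_val x y r g).
    by have [e /(monomial_val_lead xy r0) ->] := lead_exists xy r0 g0.
  apply: xget_subset1; last first.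
    by move=> t1 t2 [f [g [g0 /val0 E /E ->]]] // [f1 [g1 [g10 /val0 E1 /E1 ->]]].
  exists 0, 1; rewrite oner_neq0 tofrac0 mul0r; split=> //.
  have [e le] := lead_exists xy r0 (oner_neq0 D).
  by rewrite (monomial_val_lead xy r0 le) /monomial_val eqxx.
by move=> z0; move: Hz; rewrite monomial_valK_frac_val.
Qed.

(** * Valuation rings avoiding an element *)

Definition subring (K : fieldType) (A : set K) : Prop :=
  [/\ A 1, forall u v, A u -> A v -> A (u - v)
    & forall u v, A u -> A v -> A (u * v)].

Lemma subring_closedP (K : fieldType) (A : set K) :
  subring_closed (mem A) <-> subring A.
Proof.
split=> [[A1 AB AM]|[A1 AB AM]].
  split=> [|u v Au Av|u v Au Av]; first exact: set_mem A1.
    exact: set_mem (AB _ _ (mem_set Au) (mem_set Av)).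
  exact: set_mem (AM _ _ (mem_set Au) (mem_set Av)).
split=> [|u v /set_mem Au /set_mem Av|u v /set_mem Au /set_mem Av].
- exact: mem_set.
- exact/mem_set/AB.
- exact/mem_set/AM.
Qed.

Lemma subring0 (K : fieldType) (A : set K) : subring A -> A 0.
Proof. by case=> A1 AB _; rewrite -(subrr 1); apply: AB. Qed.

Lemma subringN (K : fieldType) (A : set K) u : subring A -> A u -> A (- u).
Proof. by move=> rA Au; rewrite -sub0r; case: (rA) => _ AB _; apply: AB => //; apply: subring0. Qed.

Lemma subringD (K : fieldType) (A : set K) u v : subring A -> A u -> A v -> A (u + v).
Proof.
move=> rA Au Av; rewrite -[v]opprK; case: (rA) => _ AB _; apply: AB => //.
exact: subringN.
Qed.

Lemma subringX (K : fieldType) (A : set K) u n : subring A -> A u -> A (u ^+ n).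
Proof.
case=> A1 _ AM Au; elim: n => [|n IHn]; rewrite ?expr0 // exprS.
exact: AM.
Qed.

Lemma subring_sum (K : fieldType) (A : set K) (I : Type) (r : seq I)
    (P : pred I) (F : I -> K) :
  subring A -> (forall i, P i -> A (F i)) -> A (\sum_(i <- r | P i) F i).
Proof.
move=> rA AF; elim/big_rec: _ => [|i z /AF]; first exact: subring0.
exact: subringD.
Qed.

Definition adjoin (K : fieldType) (A : set K) (h : K) : set K :=
  [set z | exists2 P : {poly K}, forall i, A P`_i & z = P.[h]].

Lemma subring_adjoin (K : fieldType) (A : set K) h : subring A ->
  [/\ subring (adjoin A h), A `<=` adjoin A h & adjoin A h h].
Proof.
move=> rA; case: (rA) => A1 AB AM; have A0 := subring0 rA.
split; [split| |].
- exists 1; last by rewrite hornerC.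
  by move=> i; rewrite coef1; case: eqP.
- move=> _ _ [P AP ->] [Q AQ ->]; exists (P - Q); last by rewrite hornerD hornerN.
  by move=> i; rewrite coefB; apply: AB.
- move=> _ _ [P AP ->] [Q AQ ->]; exists (P * Q); last by rewrite hornerM.
  by move=> i; rewrite coefM; apply: subring_sum => // j _; apply: AM.
- move=> c Ac; exists c%:P; last by rewrite hornerC.
  by move=> i; rewrite coefC; case: eqP.
- exists 'X; last by rewrite hornerX.
  by move=> i; rewrite coefX; case: eqP.
Qed.

(** A subring [A] that is maximal among those avoiding [w^-1] is a valuation
    ring. First, [1 - w b] is invertible in [A] for [b] in [A]. If neither [h]
    nor [h^-1] is in [A], then maximality gives equations [1 = w P(h)] and
    [1 = w Q(h^-1)] over [A]; solved for its constant term, the one of lower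
    degree reduces the degree of the other. *)
Lemma maximal_avoiding_valuation_ring (K : fieldType) (A : set K) (w : K) :
  subring A -> A w -> ~ A w^-1 ->
  (forall B, subring B -> A `<=` B -> ~ B w^-1 -> B = A) -> valuation_ring A.
Proof.
move=> rA Aw nAz maxA; case: (rA) => A1 AB AM; have A0 := subring0 rA.
have w0 : w != 0 by apply: contra_notN nAz => /eqP ->; rewrite invr0.
have adjoinz h : ~ A h -> adjoin A h w^-1.
  move=> nAh; apply: contrapT => nz; have [rB AsB Bh] := subring_adjoin h rA.
  by apply: nAh; rewrite -(maxA _ rB AsB nz).
have unit1 b : A b -> 1 - w * b != 0 /\ A (1 - w * b)^-1.
  move=> Ab; set c := 1 - w * b.
  have Ac : A c by apply: AB => //; apply: AM.
  have c0 : c != 0.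
    apply: contra_notN nAz; rewrite subr_eq0 => /eqP c0.
    by rewrite -[w^-1]mulr1 c0 mulKf.
  split=> //; apply: contrapT => /adjoinz[P AP zE]; apply: nAz.
  have [b' Ab' cE] : exists2 b', A b' & c ^+ size P = 1 - w * b'.
    elim: (size P) => [|n [b' Ab' E]]; first by exists 0; rewrite ?expr0 ?mulr0 ?subr0.
    exists (b + c * b'); last by rewrite exprS E /c; ring.
    by apply: subringD => //; apply: AM.
  have -> : w^-1 = c ^+ size P * w^-1 + b'.
    by rewrite cE mulrBl mul1r mulrAC mulfV // mul1r subrK.
  apply: subringD => //; rewrite zE horner_coef mulr_sumr.
  apply: subring_sum => // i _; rewrite mulrCA; apply: AM => //.
  rewrite exprVn -expfB ?ltn_ord //.
  exact: subringX.
pose E n h := exists2 a : nat -> K, forall i, A (a i) &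
  1 = w * \sum_(i < n.+1) a i * h ^+ i.
have E0 h : ~ E 0%N h.
  case=> a Aa; rewrite big_ord1 expr0 mulr1 => aE; apply: nAz.
  by rewrite -[w^-1]mulr1 aE mulKf.
have E_le m n h : (m <= n)%N -> E m h -> E n h.
  move=> mn [a Aa aE]; exists (fun i => if (i <= m)%N then a i else 0).
    by move=> i; case: ifP.
  rewrite {1}aE (big_ord_widen n.+1 (fun i => a i * h ^+ i)) // big_mkcond /=.
  by congr (_ * _); apply: eq_bigr => i _; rewrite ltnS; case: ifP; rewrite ?mul0r.
have reduce n h : h != 0 -> E n.+1 h -> E n.+1 h^-1 -> E n h.
  move=> h0 [a Aa aE] [b Ab bE]; have [c0 Ac] := unit1 _ (Ab 0%N).
  set c := 1 - _ in c0 Ac.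
  have hE : h ^+ n.+1 = c^-1 * (w * \sum_(j < n.+1) b j.+1 * h ^+ (n - j)).
    apply: (canRL (mulKf c0)); rewrite /c mulrBl mul1r.
    apply/eqP; rewrite subr_eq -{1}[h ^+ n.+1]mul1r {1}bE big_ord_recl expr0 mulr1.
    rewrite mulrDr mulrDl addrC; apply/eqP; congr (_ + _).
    rewrite -mulrA mulr_suml; congr (_ * _); apply: eq_bigr => j _.
    rewrite -mulrA; congr (_ * _); rewrite /= exprVn mulrC.
    by rewrite -exprB ?unitfE // ltnS -ltnS ltn_ord.
  exists (fun i => a i + a n.+1 * c^-1 * w * b (n - i).+1).
    by move=> i; apply: subringD => //; do 3?apply: (AM) => //.
  rewrite {1}aE big_ord_recr /= hE; congr (_ * _).
  under [RHS]eq_bigr do rewrite mulrDl.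
  rewrite big_split /=; congr (_ + _).
  rewrite (reindex_inj rev_ord_inj) /= !mulr_sumr; apply: eq_bigr => j _.
  by rewrite subSS subKn ?mulrA // -ltnS.
have contra N : forall m n h, (m + n <= N)%N -> h != 0 -> E m h -> E n h^-1 -> False.
  elim: N => [|N IHN] m n h mnN h0 Em En.
    by move: mnN Em; rewrite leqn0 addn_eq0 => /andP[/eqP -> _] /E0.
  have [nm|mn] := leqP n m.
    case: m => [|m] in mnN Em nm *; first exact: E0 Em.
    apply: (IHN m n h) => //; apply: reduce => //; exact: E_le En.
  case: n => [|n] in mnN En mn * => //.
  apply: (IHN m n h) => //; first by rewrite addnS in mnN.
  by apply: reduce; rewrite ?invr_eq0 ?invrK //; apply: E_le Em; apply: ltnW.
have adjoinE h : ~ A h -> exists n, E n h.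
  move=> /adjoinz[P AP zE]; exists (size P), (fun i => P`_i) => //.
  by rewrite -(@horner_coef_wide _ (size P).+1) // -zE mulfV.
split; first exact/subring_closedP.
move=> h h0; apply: contrapT => /not_orP[/adjoinE[m Em] /adjoinE[n En]].
exact: contra (leqnn _) h0 Em En.
Qed.

Lemma valuation_ring_avoiding (K : fieldType) (A0 : set K) (w : K) :
  subring A0 -> A0 w -> ~ A0 w^-1 ->
  exists V, [/\ valuation_ring V, A0 `<=` V & ~ V w^-1].
Proof.
move=> rA0 A0w nA0z.
have [||A [[rA nAz] sA maxA]] :=
  @zorn_above K [set A | subring A /\ ~ A w^-1] A0.
- by [].
- move=> F [A1 FA1] Ftot FP; split; last by case=> A /FP[_ []].
  have join A B u v : F A -> F B -> A u -> B v -> exists2 C, F C & C u /\ C v.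
    move=> FA FB Au Bv; have [AB|BA] := Ftot _ _ FA FB.
      by exists B => //; split=> //; apply: AB.
    by exists A => //; split=> //; apply: BA.
  split.
  + by exists A1 => //; have [_ [[]]] := FP _ FA1.
  + move=> u v [A FA Au] [B FB Bv]; have [C FC [Cu Cv]] := join _ _ _ _ FA FB Au Bv.
    by exists C => //; have [_ [[_ CB _] _]] := FP _ FC; apply: CB.
  + move=> u v [A FA Au] [B FB Bv]; have [C FC [Cu Cv]] := join _ _ _ _ FA FB Au Bv.
    by exists C => //; have [_ [[_ _ CM] _]] := FP _ FC; apply: CM.
exists A; split=> //; apply: (maximal_avoiding_valuation_ring rA (sA _ A0w) nAz).
by move=> B rB AB nBz; apply: maxA.
Qed.

(** * A valuation ring inside a rational monomial valuation ring *)

(** By the Archimedean property, an element [h] of [V] with [v h < 0] would give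
    [v (z / h ^+ n) > 0] for some [n], so that [z] would be in [V]. *)
Lemma valuation_ring_inside (R : realType) (K : fieldType) (v : K -> R)
    (V : set K) (z : K) :
  real_valuation v -> valuation_ring V -> valuation_ideal v `<=` V -> ~ V z ->
  V `<=` real_valuation_ring v.
Proof.
move=> vv [/subring_closedP rV _] mV nVz h Vh h0; rewrite leNgt; apply/negP => vh.
apply: nVz; have [->|z0] := eqVneq z 0; first exact: subring0.
have vh0 : 0 < - v h by rewrite oppr_gt0.
pose n := Num.bound `|- v z / - v h|.
have -> : z = h ^+ n * (h ^- n * z) by rewrite mulVKf ?expf_neq0.
case: (rV) => _ _ VM; apply: VM; first exact: subringX.
apply: mV => _; rewrite (real_valuationM vv) ?invr_eq0 ?expf_neq0 //.
rewrite (real_valuationV vv) ?expf_neq0 // (real_valuationX _ vv) //.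
rewrite -mulNrn -mulr_natl -ltrBlDr sub0r -ltr_pdivrMr //.
exact: le_lt_trans (ler_norm _) (archi_boundP (normr_ge0 _)).
Qed.

(** [h^-1] has negative value, hence is not in [V]. *)
Lemma real_valuation_ideal_in (R : realType) (K : fieldType) (v : K -> R)
    (V : set K) (h : K) :
  real_valuation v -> valuation_ring V -> V `<=` real_valuation_ring v ->
  h != 0 -> 0 < v h -> V h.
Proof.
move=> vv [_ Vtot] sV h0 vh; have [//|/sV] := Vtot h h0.
move=> /(_ (invr_neq0 h0)); rewrite (real_valuationV vv) // oppr_ge0 leNgt.
by rewrite vh.
Qed.

(** If [p = q * r], then the residue of [x^p / y^q] is transcendental over the
    residue field of [D]: after clearing denominators, the first monomial with
    a unit coefficient in the value of a polynomial [P] is initial. *)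
Lemma residue_transcendental (R : realType) (D : idomainType) (x y : D) (r : R)
    (p q : nat) (P : {poly D}) (i : nat) :
  parameters x y -> 0 < r -> (0 < p)%N -> p%:R = q%:R * r ->
  valuation_ideal (frac_val x y r)
    (map_poly (@tofrac D) P).[tofrac (x ^+ p) / tofrac (y ^+ q)] ->
  P`_i \isn't a GRing.unit.
Proof.
move=> xy r0 p0 pqr mPs; apply/negP => uPi.
have exu : exists j, P`_j \is a GRing.unit by exists i.
case: (ex_minnP exu) => {i exu uPi} k uPk kmin.
set N := size P.
have kN : (k < N)%N.
  by rewrite ltnNge; apply/negP => /(nth_default 0) Pk0; rewrite Pk0 unitr0 in uPk.
pose e j : nat * nat := (p * j, q * (N - j))%N.
have we j : (j <= N)%N -> weight r (e j) = (q * N)%:R * r.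
  move=> jN; rewrite /weight /= !natrM natrB // pqr; ring.
pose F := \sum_(j < N) P`_j * monomial x y (e j).
have y0 : tofrac y != 0 by rewrite tofrac_eq0 (param_neq0 (parameters_sym xy)).
have FE : (map_poly (@tofrac D) P).[tofrac (x ^+ p) / tofrac (y ^+ q)] =
    tofrac F / tofrac (monomial x y (0, q * N)%N).
  apply: (canRL (mulfK _)).
    by rewrite /monomial expr0 mul1r tofracXn expf_neq0.
  rewrite horner_coef size_map_inj_poly ?tofrac0 //; last first.
    by move=> f g /eqP; rewrite tofrac_eq => /eqP.
  rewrite mulr_suml raddf_sum; apply: eq_bigr => j _.
  rewrite coef_map /monomial /= expr0 mul1r !tofracM -mulrA; congr (_ * _).
  rewrite exprMn exprVn !tofracXn -!exprM -mulrA; congr (_ * _).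
  by rewrite mulrC -exprB ?unitfE // ?leq_mul // 1?ltnW // mulnBr.
have lF : lead x y r F (e k).
  exists P`_k, (\sum_(j < N | j != Ordinal kN) P`_j * monomial x y (e j)).
  split=> //; last by rewrite /F (bigD1 (Ordinal kN)).
  have idL := ideal_beyond x y r (e k); case: (idL) => _ _ LD LM.
  apply: ideal_in_sum => // j jk.
  have weE : weight r (e j) = weight r (e k) by rewrite !we // ltnW.
  have [kj|jk'|kj] := ltngtP k j.
  - apply: (LM) => //; apply: beyond_monomial.
    by rewrite beforeE weE lexx /= ltn_pmul2l.
  (* A coefficient in [(x, y)] raises the weight. *)
  - have /(param_maximal xy)[a [b ->]] : P`_j \isn't a GRing.unit.
      by apply/negP => /kmin; rewrite leqNgt jk'.
    have -> : (a * x + b * y) * monomial x y (e j) =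
        a * monomial x y (eadd (1, 0)%N (e j)) + b * monomial x y (eadd (0, 1)%N (e j)).
      by rewrite !monomial_eadd /monomial /= !expr0 !expr1; ring.
    apply: (LD); apply: (LM) => //; apply: beyond_monomial; apply: weight_before.
      by rewrite weight_eadd weE /weight /= mul0r addr0 ltrDr.
    by rewrite weight_eadd weE /weight /= mul1r add0r ltrDr.
  - by move: jk; rewrite -val_eqE /= kj eqxx.
have := mPs; rewrite FE /valuation_ideal /=.
rewrite (frac_valE xy r0 lF (lead_monomial _ _ _ _)) we ?(ltnW kN) //.
rewrite mulf_eq0 invr_eq0 !tofrac_eq0 negb_or (lead_neq0 xy r0 lF).
rewrite (lead_neq0 xy r0 (lead_monomial x y r _)) => /(_ isT).
by rewrite /weight /= add0r subrr ltxx.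
Qed.

(** The preimage in the ring of [v] of the subring of the residue field
    generated by the residues of [phi D] and of [s]. *)
Lemma subring_residue (R : realType) (D : idomainType) (K : fieldType)
    (phi : {rmorphism D -> K}) (v : K -> R) (s : K) :
  real_valuation v -> (forall f, real_valuation_ring v (phi f)) ->
  real_valuation_ring v s ->
  subring [set h | exists P : {poly D}, valuation_ideal v (h - (map_poly phi P).[s])].
Proof.
move=> vv ophi os; pose ev (P : {poly D}) := (map_poly phi P).[s].
have oev P : real_valuation_ring v (ev P).
  rewrite /ev; elim/poly_ind: P => [|P c IHP].
    by rewrite rmorph0 horner0; rewrite /real_valuation_ring /= eqxx.
  rewrite rmorphD rmorphM /= map_polyX map_polyC /= hornerMXaddC.
  apply: (real_valuation_ring_add vv) => //.
  exact: (real_valuation_ring_mul vv).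
have m0 : valuation_ideal v 0 by rewrite /valuation_ideal /= eqxx.
split.
- by exists 1; rewrite rmorph1 hornerC subrr.
- move=> g h [P mg] [Q mh]; exists (P - Q); rewrite rmorphB /= hornerD hornerN.
  rewrite (_ : g - h - _ = (g - ev P) - (h - ev Q)); last by rewrite /ev; ring.
  exact: (valuation_ideal_sub vv mg mh).
- move=> g h [P mg] [Q mh]; exists (P * Q); rewrite rmorphM hornerM.
  have oh : real_valuation_ring v h.
    rewrite -(subrK (ev Q) h); apply: (real_valuation_ring_add vv _ (oev Q)).
    by move=> /mh /ltW.
  rewrite (_ : _ - _ = h * (g - ev P) - ev P * (0 - (h - ev Q))); last first.
    by rewrite /ev; ring.
  apply: (valuation_ideal_sub vv (valuation_ideal_mul vv oh mg)).
  exact: (valuation_ideal_mul vv (oev P) (valuation_ideal_sub vv m0 mh)).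
Qed.

(** [V_r], for [r = p / q], contains a valuation ring over [D] that omits
    [1 / (1 + s)], where [s = x^p / y^q]: the residue of [s] being
    transcendental, [1 + s] is not invertible in the subring [A0] of [V_r]
    generated by [D], [s] and the maximal ideal of [V_r]. *)
Lemma rational_avoiding_valuation_ring (R : realType) (D : idomainType) (x y : D)
    (r : R) (p q : nat) :
  parameters x y -> 0 < r -> (0 < p)%N -> p%:R = q%:R * r ->
  exists V, [/\ valuation_ring V, range (@tofrac D) `<=` V,
    V `<=` real_valuation_ring (frac_val x y r)
    & ~ V (1 + tofrac (x ^+ p) / tofrac (y ^+ q))^-1].
Proof.
move=> xy r0 p0 pqr; set s := _ / _; set v := frac_val x y r.
have vv : real_valuation v by apply: frac_val_valuation.
have os : real_valuation_ring v s.
  have xE : x ^+ p = monomial x y (p, 0)%N by rewrite /monomial expr0 mulr1.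
  have yE : y ^+ q = monomial x y (0, q)%N by rewrite /monomial expr0 mul1r.
  move=> _; rewrite /s /v xE yE.
  rewrite (frac_valE xy r0 (lead_monomial _ _ _ _) (lead_monomial _ _ _ _)).
  by rewrite /weight /= mul0r addr0 add0r pqr subrr.
pose ev (P : {poly D}) := (map_poly (@tofrac D) P).[s].
pose A0 : set {fraction D} := [set h | exists P, valuation_ideal v (h - ev P)].
have ovD f : real_valuation_ring v (tofrac f) by apply: tofrac_ring.
have rA0 : subring A0 := subring_residue vv ovD os.
have m0 : valuation_ideal v 0 by rewrite /valuation_ideal /= eqxx.
have evA0 P : A0 (ev P) by exists P; rewrite subrr.
have evM P Q : ev (P * Q) = ev P * ev Q by rewrite /ev rmorphM hornerM.
have evB P Q : ev (P - Q) = ev P - ev Q by rewrite /ev rmorphB /= hornerD hornerN.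
have ev1 : ev 1 = 1 by rewrite /ev rmorph1 hornerC.
have evw : ev (1 + 'X) = 1 + s.
  by rewrite /ev rmorphD rmorph1 /= map_polyX hornerD hornerC hornerX.
have ow : real_valuation_ring v (1 + s).
  by apply: (real_valuation_ring_add vv _ os); rewrite -(tofrac1 D).
have nA0 : ~ A0 (1 + s)^-1.
  case=> P mz; have w0 : 1 + s != 0.
    apply/eqP => w0.
    have := @residue_transcendental R D x y r p q (1 + 'X) 0 xy r0 p0 pqr.
    rewrite -/s -/(ev _) evw w0 coefD coef1 coefX addr0 unitr1.
    by move=> H; suff: ~~ true by []; apply: H.
  (* If [(1 + s)^-1] and [P(s)] have equal residues, then the residue of [s] is
     a root of [Q]; but [Q] takes the value 1 at [-1], so that not all of its
     coefficients are in the maximal ideal. *)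
  pose Q := 1 - (1 + 'X) * P.
  have mQ : valuation_ideal v (ev Q).
    rewrite /Q evB ev1 evM evw (_ : _ - _ = (1 + s) * ((1 + s)^-1 - ev P)).
      exact: (valuation_ideal_mul vv ow mz).
    by rewrite mulrBr mulfV.
  have nuQ i : exists a b, Q`_i = a * x + b * y.
    apply: (param_maximal xy).
    exact: (residue_transcendental i xy r0 p0 pqr mQ).
  have : exists a b, Q.[-1] = a * x + b * y.
    rewrite horner_coef; elim/big_ind: _ => [|_ _ [a [b ->]] [c [d ->]]|i _].
    - by exists 0, 0; rewrite !mul0r addr0.
    - by exists (a + c), (b + d); ring.
    - have [a [b ->]] := nuQ i.
      by exists (a * (-1) ^+ i), (b * (-1) ^+ i); ring.
  rewrite /Q hornerD hornerN hornerM hornerD !hornerC hornerX subrr mul0r subr0.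
  by case=> a [b E]; have := param_nonunit xy a b; rewrite -E unitr1.
(* A valuation ring over [A0] contains the maximal ideal of [v]. *)
have [V [vV A0V nV]] := valuation_ring_avoiding rA0 (A0 := A0) (w := 1 + s)
  (eq_ind _ A0 (evA0 _) _ evw) nA0.
exists V; split=> //.
  move=> _ [f _ <-]; apply: A0V; have -> : tofrac f = ev f%:P; last exact: evA0.
  by rewrite /ev map_polyC /= hornerC.
apply: (valuation_ring_inside vv vV _ nV) => h mh; apply: A0V; exists 0.
by rewrite /ev rmorph0 horner0 subr0.
Qed.

(** Write the element as [(y^q + x^p) / y^q]. A numerator of value greater than
    that of [y^q] would lie in the ideal [(x, y^(q+1))], as does [x^p], and
    hence so would [y^q]. *)
Lemma frac_val_one_add_le0 (R : realType) (D : idomainType) (x y : D) (r : R)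
    (p q : nat) : parameters x y -> 0 < r -> (0 < p)%N ->
  1 + tofrac (x ^+ p) / tofrac (y ^+ q) != 0 /\
  frac_val x y r (1 + tofrac (x ^+ p) / tofrac (y ^+ q)) <= 0.
Proof.
move=> xy r0 p0.
have y0 : tofrac (y ^+ q) != 0.
  by rewrite tofrac_eq0 expf_neq0 // (param_neq0 (parameters_sym xy)).
have yE : y ^+ q = monomial x y (0, q)%N by rewrite /monomial expr0 mul1r.
have nc : ~ corner x y (0, q)%N (y ^+ q + x ^+ p).
  move=> cf; apply: (monomial_notin_corner (e := (0, q)%N) xy).
  rewrite -yE -(addrK (x ^+ p) (y ^+ q)); apply: ideal_in_sub => //.
    exact: ideal_corner.
  have -> : x ^+ p = monomial x y (p, 0)%N by rewrite /monomial expr0 mulr1.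
  by apply: corner_monomial; rewrite p0.
have f0 : y ^+ q + x ^+ p != 0.
  by apply: contra_notN nc => /eqP ->; case: (ideal_corner x y (0, q)%N).
have -> : 1 + tofrac (x ^+ p) / tofrac (y ^+ q) =
    tofrac (y ^+ q + x ^+ p) / tofrac (y ^+ q).
  by rewrite tofracD mulrDl mulfV.
split.
  by apply: mulf_neq0; rewrite ?invr_eq0 // tofrac_eq0.
have [e le] := lead_exists xy r0 f0.
rewrite {2}yE (frac_valE xy r0 le (lead_monomial _ _ _ _)) subr_le0 leNgt.
apply/negP => /weight_before lt; apply: nc; apply: (beyond_corner r0).
exact: before_lead_beyond le.
Qed.

(** * Elements almost integral over the interval ring *)

Lemma rational_between (R : realType) (a b : R) : 0 < a -> a < b ->
  exists r p q, [/\ a < r < b, (0 < p)%N & p%:R = q%:R * r].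
Proof.
move=> a0 ab; have [t] := rat_in_itvoo ab; rewrite in_itv /= => /andP[at' tb].
have t0 : 0 < t by rewrite -(@ltr0q R); apply: lt_trans at'.
exists (ratr t), `|numq t|%N, `|denq t|%N; split; first by rewrite at'.
  by rewrite absz_gt0 numq_eq0 gt_eqF.
have -> : (`|denq t|%N%:R : R) = (denq t)%:~R by rewrite pmulrn absz_denq.
have -> : (`|numq t|%N%:R : R) = (numq t)%:~R by rewrite pmulrn gtz0_abs ?numq_gt0.
by rewrite /ratr mulrC divfK // intr_eq0 denq_neq0.
Qed.

Lemma subring_interval_ring (R : realType) (D : idomainType) (x y : D) (a b : R) :
  subring (interval_ring x y a b).
Proof.
split=> [V [[/subring_closedP[]]]|u v Tu Tv V HV|u v Tu Tv V HV] //.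
  by case: (HV) => [[/subring_closedP[_ VB _] _] _ _]; apply: VB; [apply: Tu|apply: Tv].
by case: (HV) => [[/subring_closedP[_ _ VM] _] _ _]; apply: VM; [apply: Tu|apply: Tv].
Qed.

(** The ideal generated by the [c * z ^+ n] is finitely generated, which makes
    [z] integral over [T], and valuation rings are integrally closed. *)
Lemma noetherian_almost_integral (K : fieldType) (T V : set K) (c z : K) :
  subring T -> noetherian T -> valuation_ring V -> T `<=` V ->
  c != 0 -> (forall n, T (c * z ^+ n)) -> V z.
Proof.
move=> rT noethT [/subring_closedP rV Vtot] TV c0 Tcz.
case: (rT) => T1 _ TM; case: (rV) => _ _ VM; have T0 := subring0 rT.
pose J : set K := [set h | exists2 P : {poly K}, forall i, T P`_i & h = c * P.[z]].
have idJ : ideal_in T J.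
  split.
  - move=> _ [P TP ->]; rewrite horner_coef mulr_sumr; apply: subring_sum => // i _.
    by rewrite mulrCA; apply: TM.
  - by exists 0; rewrite ?horner0 ?mulr0 // => i; rewrite coef0.
  - move=> _ _ [P TP ->] [Q TQ ->]; exists (P + Q); last by rewrite hornerD mulrDr.
    by move=> i; rewrite coefD; apply: subringD.
  - move=> t _ Tt [P TP ->]; exists (t *: P); last by rewrite hornerZ mulrCA.
    by move=> i; rewrite coefZ; apply: TM.
have [n [g [_ Jg]]] := noethT J idJ.
have gJ i : J (g i).
  rewrite Jg; exists (fun j => (j == i)%:R) => [j|]; first by case: eqP.
  rewrite (bigD1 i) //= eqxx mul1r big1 ?addr0 // => j /negbTE ->.
  by rewrite mul0r.
have /choice[P Pg] : forall i, exists P : {poly K},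
    (forall i, T P`_i) /\ g i = c * P.[z].
  by move=> i; have [P TP gE] := gJ i; exists P.
(* The generators only involve the [c * z ^+ i] with [i < N]. *)
pose N := \max_(i < n) size (P i).
have [Q TQ [sQ zE]] : exists2 Q : {poly K}, forall i, T Q`_i &
    (size Q <= N)%N /\ z ^+ N = Q.[z].
  have : J (c * z ^+ N).
    exists 'X^N; last by rewrite hornerXn.
    by move=> i; rewrite coefXn; case: eqP.
  rewrite Jg => -[t Tt E]; exists (\sum_(i < n) t i *: P i).
    move=> i; rewrite coef_sum; apply: subring_sum => // j _.
    by rewrite coefZ; apply: TM => //; case: (Pg j).
  split.
    apply: (leq_trans (size_sum _ _ _)); apply/bigmax_leqP => i _.
    by apply: leq_trans (size_scale_leq _ _) _; apply: leq_bigmax.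
  apply: (mulfI c0); rewrite E horner_sum mulr_sumr; apply: eq_bigr => i _.
  by rewrite hornerZ mulrCA; case: (Pg i) => _ ->.
have [->|z0] := eqVneq z 0; first exact: subring0.
have [//|Vz'] := Vtot z z0.
(* The integral equation [z ^+ N = Q(z)], divided by [z ^+ N.-1]. *)
have -> : z = \sum_(i < N) Q`_i * z^-1 ^+ (N.-1 - i).
  have [N0|N0] := posnP N.
    move: zE; rewrite N0 expr0; have -> : Q = 0.
      by apply/eqP; rewrite -size_poly_leq0 -N0.
    by rewrite horner0 => /eqP; rewrite oner_eq0.
  apply: (mulIf (expf_neq0 N.-1 z0)); rewrite -exprS prednK // zE.
  rewrite (horner_coef_wide _ sQ) mulr_suml; apply: eq_bigr => i _.
  rewrite -mulrA; congr (_ * _); rewrite exprVn mulrC -exprB ?unitfE //.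
    by rewrite subKn // -ltnS prednK.
  exact: leq_subr.
apply: subring_sum => // i _; apply: VM; first exact/TV.
exact: subringX.
Qed.

Theorem mainTheorem3 (R : realType) (D : idomainType) (x y : D) (a b : R)
    (hD : regular_local2 x y) (ha : 0 < a) (hab : a < b) :
  ~ noetherian (interval_ring x y a b) /\
  ~ completely_integrally_closed (interval_ring x y a b).
Proof.
have xy := regular_local2_parameters hD.
have [r0 [p [q [/andP[ar0 r0b] p0 pqr]]]] := rational_between ha hab.
have r0_gt0 := lt_trans ha ar0.
set T := interval_ring x y a b; pose w := 1 + tofrac (x ^+ p) / tofrac (y ^+ q).
have [V [vV DV sV nVz]] := rational_avoiding_valuation_ring xy r0_gt0 p0 pqr.
have TV : T `<=` V.
  move=> t; apply; split=> //; exists r0; first by rewrite !ltW.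
  by rewrite monomial_val_ringE.
have x0 : tofrac x != 0 by rewrite tofrac_eq0 (param_neq0 xy).
have xz n : T (tofrac x * w^-1 ^+ n).
  move=> W [vW DW [r /andP[ar rb] sW]]; have r_gt0 := lt_le_trans ha ar.
  rewrite monomial_val_ringE // in sW.
  have vv := frac_val_valuation xy r_gt0.
  have [w0 vw] := frac_val_one_add_le0 q xy r_gt0 p0.
  have wn0 : w^-1 ^+ n != 0 by rewrite expf_neq0 ?invr_neq0.
  apply: (real_valuation_ideal_in vv vW sW); first exact: mulf_neq0.
  rewrite (real_valuationM vv) // (real_valuationX _ vv) ?invr_neq0 //.
  rewrite (real_valuationV vv) //; apply: ltr_wpDr.
    by rewrite mulrn_wge0 // oppr_ge0.
  have xE : x = monomial x y (1, 0)%N by rewrite /monomial expr0 expr1 mulr1.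
  rewrite [X in tofrac X]xE (frac_val_tofrac xy r_gt0 (lead_monomial _ _ _ _)).
  by rewrite /weight mul0r addr0.
split=> [noethT|ciT].
  have rT : subring T := subring_interval_ring x y a b.
  exact: (nVz (noetherian_almost_integral rT noethT vV TV x0 xz)).
apply: nVz; apply: TV; apply: ciT; exists (tofrac x).
split; [exact: x0| |by move=> n _; exact: xz].
by have := xz 0%N; rewrite expr0 mulr1.
Qed.
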